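(* (PBW type theorem in Shirshov form) Let $GDN(X)$ be the free Gelfand-Dorfman-Novikov algebra and $k\{X\}$ the free commutative differential algebra on $X$, let $S\subseteq GDN(X)$, and let $S^{c}$ be a Gröbner-Shirshov basis in $k\{X\}$ obtained from $S$ by the Buchberger-Shirshov algorithm. Then: (i) $S'=\{uD^{m}s\mid s\in S^{c},\ u\in[D^{\omega}X],\ m\in\mathbb{N},\ wt(u\overline{D^{m}s})=-1\}$ is a Gröbner-Shirshov basis in $GDN(X)$. (ii) The set $Irr(S')=\{w\in[D^{\omega}X]\mid wt(w)=-1,\ w\neq u\overline{D^{t}s}\text{ for all }u\in[D^{\omega}X],\,t\in\mathbb{N},\,s\in S^{c}\}=GDN(X)\cap Irr[S^{c}]$ is a linear basis of $GDN(X|S)$. Thus, any Gelfand-Dorfman-Novikov algebra $GDN(X|S)$ is embeddable into its universal enveloping commutative differential algebra $k\{X|S\}$.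
   Context: Let $k$ be a field of characteristic $0$, $X$ a well-ordered set, $\mathbb{N}=\{0,1,2,\dots\}$. $k\{X\}$ is the commutative polynomial algebra over $k$ in the letters $a[i]$ ($a\in X$, $i\ge -1$), with the $k$-linear derivation $D$ given by $D(a[i])=a[i+1]$, $D(1)=0$ (so $a[-1]=a$, $a[i]=D^{i+1}a$). $[D^{\omega}X]$ is the free commutative monoid on these letters; it is a $k$-basis of $k\{X\}$. For $w=a_n[i_n]\cdots a_1[i_1]$ put $|w|=n$ and $wt(w)=i_1+\dots+i_n$; $|1|=wt(1)=0$. Order: $a[i]<b[j]$ iff $(i,a)<(j,b)$ lexicographically. For $w=a_n[i_n]\cdots a_1[i_1]$ with $a_n[i_n]\ge\dots\ge a_1[i_1]$ put $ord(w)=(|w|,a_n[i_n],\dots,a_1[i_1])$, and $u<v$ iff $ord(u)<ord(v)$ lexicographically; this is a well order on $[D^\omega X]$. For nonzero $f\in k\{X\}$, $\overline f$ is its leading word and $LC(f)$ the coefficient of $\overline f$. Conditions involving a leading word $\overline{D^t s}$ only concern $s$ with $D^ts\ne0$. $GDN(X)$ is the span of $\{w\in[D^\omega X]\mid wt(w)=-1\}$ with the product $f\circ g=(Df)g$. It is the free (right-)Gelfand-Dorfman-Novikov algebra on $X$ (with $a\in X$ identified with $a[-1]$), where such algebras are defined by the identities $x\circ(y\circ z)-(x\circ y)\circ z=x\circ(z\circ y)-(x\circ z)\circ y$ and $x\circ(y\circ z)=y\circ(x\circ z)$. For $S\subseteq GDN(X)$, $GDN(X|S)=GDN(X)/Id(S)$,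 where $Id(S)$ is the (two-sided, for $\circ$) ideal generated by $S$. $Id[S]$ is the differential ideal of $k\{X\}$ generated by $S$ (closed under $D$), and $k\{X|S\}=k\{X\}/Id[S]$ is the universal enveloping commutative differential algebra of $GDN(X|S)$; every commutative differential algebra is regarded as a Gelfand-Dorfman-Novikov algebra via $f\circ g=(Df)g$, and ''embeddable'' refers to this product. Gröbner-Shirshov bases in $k\{X\}$: for $f,g\in k\{X\}$ and $t_1,t_2\in\mathbb{N}$, let $w=lcm(\overline{D^{t_1}f},\overline{D^{t_2}g})$ (least common multiple in $[D^\omega X]$). If $|w|<|\overline{D^{t_1}f}|+|\overline{D^{t_2}g}|$ (a non-trivial lcm), write $w=u_1\overline{D^{t_1}f}=u_2\overline{D^{t_2}g}$ and define the composition $[D^{t_1}f,D^{t_2}g]_w=\frac1{\alpha_1}u_1D^{t_1}f-\frac1{\alpha_2}u_2D^{t_2}g$, $\alpha_1=LC(D^{t_1}f)$, $\alpha_2=LC(D^{t_2}g)$. It is trivial with respect to $S$ if it is a finite sum $\sum\gamma_iu_iD^{t_i}s_i$ with $\gamma_i\in k$, $u_i\in[D^\omega X]$, $t_i\in\mathbb{N}$, $s_i\in S$ and $\overline{u_iD^{t_i}s_i}<w$. $S$ is a Gröbner-Shirshov basis in $k\{X\}$ if all compositions of elements of $S$ are trivial with respect to $S$. $Irr[S]=\{w\in[D^\omega X]\mid w\ne u\overline{D^ts},\ u\in[D^\omega X],t\in\mathbb{N},s\in S\}$. Buchberger-Shirshov algorithm: add to $S$ all non-trivial compositions of $S$, and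 repeat this process (possibly infinitely often, taking the union of the resulting increasing chain of sets); the result is a Gröbner-Shirshov basis $S^c\supseteq S$ in $k\{X\}$. Gröbner-Shirshov bases in $GDN(X)$: for $f,g\in GDN(X)$, $t_1,t_2\in\mathbb{N}$, a non-trivial common multiple of $\overline{D^{t_1}f}$ and $\overline{D^{t_2}g}$ in $GDN(X)$ is a word $w$ with $wt(w)=-1$ that is a common multiple of both in $[D^\omega X]$ and is not of the form $\overline{D^{t_1}f}\,\overline{D^{t_2}g}\,w'$ with $w'\in[D^\omega X]$. For such $w=u_1\overline{D^{t_1}f}=u_2\overline{D^{t_2}g}$ the composition is $(D^{t_1}f,D^{t_2}g)_w=\frac{1}{\alpha_1}u_1D^{t_1}f-\frac1{\alpha_2}u_2D^{t_2}g$ with $\alpha_1=LC(D^{t_1}f)$, $\alpha_2=LC(D^{t_2}g)$. It is trivial with respect to $T\subseteq GDN(X)$ if it is a finite sum $\sum\beta_iu_iD^{t_i}s_i$ with $\beta_i\in k$, $u_i\in[D^\omega X]$, $t_i\in\mathbb{N}$, $s_i\in T$, $wt(\overline{u_iD^{t_i}s_i})=-1$ and $\overline{u_iD^{t_i}s_i}<w$. $T$ is a Gröbner-Shirshov basis in $GDN(X)$ if all compositions of elements of $T$ are trivial with respect to $T$. For $T\subseteq GDN(X)$, $Irr(T)=\{w\in[D^\omega X]\mid wt(w)=-1,\ w\ne u\overline{D^ts}\ \text{for all } u\in[D^\omega X],t\in\mathbb{N},s\in T\}$. *)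

(* Defs.v *)
From HB Require Import structures.
From mathcomp Require Import all_boot all_order all_algebra.
From mathcomp Require Import finmap zify ring.
From mathcomp Require Import boolp classical_sets.
From mathcomp.multinomials Require Import monalg.

Set Implicit Arguments.
Unset Strict Implicit.
Unset Printing Implicit Defensive.

Import Order.TTheory GRing.Theory Num.Theory.
Local Open Scope ring_scope.
Local Open Scope classical_set_scope.
Local Open Scope quotient_scope.

Notation "1" := (@mone _) : monom_scope.
Notation "u * v" := (mmul u v) : monom_scope.

(* The pair (n, a) encodes the letter a[n - 1] = D^n a. *)
Notation letter X := (nat *l X)%type.
Notation word X := {cmonom (letter X)}.
Notation dpoly k X := {malg k[word X]}.

Section Words.
Context (d : Order.disp_t) (X : orderType d).
Implicit Types (u v w : word X) (l : letter X).

(* Each letter is listed with its multiplicity in w. *)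
Definition letters w : seq (letter X) :=
  flatten [seq nseq (w l) l | l <- finsupp w].

(* (|w|, a_n[i_n], ..., a_1[i_1]) with letters in decreasing order; nat *l _
   and seqlexi carry the lexicographic orders. *)
Definition ord w : (nat *l seqlexi (letter X))%type :=
  (mdeg w, sort >=%O (letters w)).

Definition word_le u v : bool := (ord u <= ord v)%O.

Definition wt w : int := \sum_(l <- finsupp w) (l.1%:Z - 1) *+ w l.

Definition lcm_word u v : word X :=
  [cmonom maxn (u l) (v l) | l in (finsupp u `|` finsupp v)%fset]%M.

Definition dletter l : letter X := (l.1.+1, l.2).

Lemma count_letters w l : count_mem l (letters w) = w l.
Proof.
rewrite /letters count_flatten -map_comp sumnE big_map.
rewrite (eq_bigr (fun j => (j == l) * w j)%N); last first.
  by move=> j _ /=; rewrite count_nseq.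
case: (mdomP w l) => [ls|lNs].
  rewrite (big_fsetD1 l) //= eqxx mul1n big_seq big1 ?addn0 // => j.
  by rewrite in_fsetD1 => /andP[/negbTE-> _].
rewrite big_seq big1 // => j js; case: eqP => // jl.
by rewrite -jl js in lNs.
Qed.

Lemma ord_inj : injective ord.
Proof.
move=> u v [_ uv]; apply/eqP/cmP => l; rewrite -2!count_letters.
have /permP uvE : perm_eq (letters u) (letters v).
  by rewrite -(perm_sort >=%O) uv perm_sort.
exact: uvE.
Qed.

Fact word_display : Order.disp_t. Proof. exact: Order.Disp tt tt. Qed.

Fact word_le_refl : reflexive word_le.
Proof. by move=> u; apply: lexx. Qed.

Fact word_le_anti : antisymmetric word_le.
Proof. by move=> u v uv; apply/ord_inj/le_anti. Qed.

Fact word_le_trans : transitive word_le.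
Proof. by move=> v u w; apply: le_trans. Qed.

HB.instance Definition _ := Order.Le_isPOrder.Build word_display (word X)
  word_le_refl word_le_anti word_le_trans.

HB.instance Definition _ := @Order.MonoTotal.Build word_display (word X)
  _ _ ord (fun _ _ => erefl).

Lemma wtEw (E : {fset letter X}) w : (finsupp w `<=` E)%fset ->
  wt w = \sum_(l <- E) (l.1%:Z - 1) *+ w l.
Proof.
move=> sub; rewrite /wt (big_fset_incl _ sub) // => l _.
by rewrite -cmE_neq0 negbK => /eqP->.
Qed.

Lemma wtM u v : wt (u * v)%M = wt u + wt v.
Proof.
rewrite (wtEw (fsubsetUl (finsupp u) (finsupp v))).
rewrite (wtEw (fsubsetUr (finsupp u) (finsupp v))).
rewrite {1}/wt mdomD -big_split /=.
by apply: eq_bigr => l _; rewrite cmM mulrnDr.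
Qed.

Lemma wt_letter l : wt (ucm l) = l.1%:Z - 1.
Proof. by rewrite /wt mdomU big_seq_fset1 cmUU mulr1n. Qed.

Lemma divcm_letterK w l : l \in finsupp w -> (divcm w (ucm l) * ucm l)%M = w.
Proof.
move=> lw; apply/eqP/cmP => j; rewrite cmM divcmE cmU subnK //.
by case: eqP => // <-; rewrite lt0n cmE_neq0.
Qed.

End Words.

Section Leibniz.
Context (k : comNzRingType) (A : comAlgType k) (D : {linear A -> A}).

Lemma leibniz_scale (p q : A) (c : k) : D (p * q) = D p * q + p * D q ->
  D (p * (c *: q)) = D p * (c *: q) + p * D (c *: q).
Proof.
move=> pq; rewrite [D (c *: q)]linearZ -!scalerAr [LHS]linearZ /= pq.
by rewrite scalerDr.
Qed.

Lemma leibniz_sum (I : Type) (p : A) (r : seq I) (F : I -> A) :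
    (forall i, D (p * F i) = D p * F i + p * D (F i)) ->
  D (p * \sum_(i <- r) F i) =
  D p * (\sum_(i <- r) F i) + p * D (\sum_(i <- r) F i).
Proof.
move=> pF; rewrite !mulr_sumr !linear_sum mulr_sumr -big_split /=.
by apply: eq_bigr => i _; apply: pF.
Qed.

Lemma leibnizC (p q : A) :
  D (p * q) = D p * q + p * D q -> D (q * p) = D q * p + q * D p.
Proof. by move=> pq; rewrite mulrC pq addrC mulrC [D p * q]mulrC. Qed.

End Leibniz.

(* Leibniz rule: for each letter l of w, of multiplicity w l, replace one
   occurrence of l by D l. *)
HB.lock Definition dword (k : fieldType) (d : Order.disp_t) (X : orderType d)
    (w : word X) : dpoly k X :=
  \sum_(l <- finsupp w)
    (w l)%:R *: << (divcm w (ucm l) * ucm (dletter l))%M >>.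
Arguments dword {k d X} w.

(* The derivation D; see dop_letter and dopM below. *)
HB.lock Definition dop (k : fieldType) (d : Order.disp_t) (X : orderType d)
    (f : dpoly k X) : dpoly k X := \sum_(w <- msupp f) f@_w *: dword w.
Arguments dop {k d X} f.

Section DifferentialPolynomials.
Context (k : fieldType) (d : Order.disp_t) (X : orderType d).
Implicit Types (f g : dpoly k X) (w : word X) (a c : k).

(* 1 is the least word; lead 0 = 1 is a junk value. *)
Definition lead f : word X := \big[Order.max/1%M]_(w <- msupp f) w.

Definition lc f : k := f@_(lead f).

Lemma dwordE (E : {fset letter X}) w : (finsupp w `<=` E)%fset ->
  dword w = \sum_(l <- E)
    (w l)%:R *: << (divcm w (ucm l) * ucm (dletter l))%M >> :> dpoly k X.
Proof.
move=> sub; rewrite dword.unlock (big_fset_incl _ sub) // => l _.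
by rewrite -cmE_neq0 negbK => /eqP->; rewrite scale0r.
Qed.

Lemma dopEw (E : {fset word X}) f : (msupp f `<=` E)%fset ->
  dop f = \sum_(w <- E) f@_w *: dword w.
Proof.
move=> sub; rewrite dop.unlock (big_fset_incl _ sub) // => w _.
by rewrite -mcoeff_eq0 => /eqP->; rewrite scale0r.
Qed.

Fact dop_is_linear : linear (dop : dpoly k X -> dpoly k X).
Proof.
move=> a f g; pose E := (msupp f `|` msupp g)%fset.
have subE : (msupp (a *: f + g)%R `<=` E)%fset.
  apply: (fsubset_trans (msuppD_le _ _)); apply: fsetSU; exact: msuppZ_le.
rewrite (dopEw subE) (@dopEw E f) ?fsubsetUl // (@dopEw E g) ?fsubsetUr //.
rewrite scaler_sumr -big_split /=; apply: eq_bigr => w _.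
by rewrite mcoeffD mcoeffZ scalerDl scalerA.
Qed.
HB.instance Definition _ := GRing.isLinear.Build k (dpoly k X) (dpoly k X) _
  (@dop k d X) dop_is_linear.

Lemma dopZ c f : dop (c *: f) = c *: dop f.
Proof. exact: linearZ. Qed.

Lemma dopU w : dop << w >> = dword w :> dpoly k X.
Proof. by rewrite (dopEw msuppU_le) big_seq_fset1 mcoeffUU scale1r. Qed.

Lemma dop_letter (l : letter X) : dop << ucm l >> = << ucm (dletter l) >> :> dpoly k X.
Proof.
rewrite dopU dword.unlock mdomU big_seq_fset1 cmUU mulr1n scale1r.
suff -> : (divcm (ucm l) (ucm l) * ucm (dletter l))%M = ucm (dletter l) by [].
by apply/eqP/cmP => j; rewrite cmM divcmE subnn.
Qed.

Lemma malgUM (u v : word X) : << (u * v)%M >> = << u >> * << v >> :> dpoly k X.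
Proof. by rewrite [RHS]fgmulUU mulr1. Qed.

Lemma malgUZ c w : << c *g w >> = c *: << w >> :> dpoly k X.
Proof.
apply/malgP => j; rewrite mcoeffZ [LHS]mcoeffU [X in _ * X]mcoeffU.
by case: eqP => _; rewrite ?mulr1n ?mulr1 ?mulr0n ?mulr0.
Qed.

Lemma dwordM (u v : word X) :
  dword (u * v)%M = dword u * << v >> + << u >> * dword v :> dpoly k X.
Proof.
have half (u' v' : word X) (E : {fset letter X}) : (finsupp u' `<=` E)%fset ->
    dword u' * << v' >> = \sum_(l <- E) (u' l)%:R *:
      << (divcm (u' * v')%M (ucm l) * ucm (dletter l))%M >> :> dpoly k X.
  move=> sub; rewrite (dwordE sub) mulr_suml; apply: eq_bigr => l _.
  have [->|u'l] := eqVneq (u' l) 0%N; first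
    by rewrite mulr0n [RHS]scale0r [X in X * _]scale0r mul0r.
  rewrite -scalerAl -malgUM; congr (_ *: << _ >>).
  apply/eqP/cmP => j; rewrite !cmM !divcmE !cmM cmU.
  by case: eqP => [<-|_] /=; move: u'l; case: (u' l) => //= *; lia.
set E := (finsupp u `|` finsupp v)%fset.
have uE := half u v E (fsubsetUl _ _); have vE := half v u E (fsubsetUr _ _).
have uvE : (finsupp (u * v)%M `<=` E)%fset by rewrite mdomD.
rewrite [<< u >> * _]mulrC uE vE (dwordE uvE) -big_split /=.
apply: eq_bigr => l _.
by rewrite cmM natrD scalerDl [(v * u)%M]mulmC.
Qed.

Lemma dopM f g : dop (f * g) = dop f * g + f * dop g.
Proof.
have mon (u w : word X) : dop (<< u >> * << w >>) =
    dop << u >> * << w >> + << u >> * dop << w >> :> dpoly k X.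
  by rewrite -malgUM [LHS]dopU dwordM -[dword u]dopU -[dword w]dopU.
rewrite (monalgE g); apply: leibniz_sum => w; rewrite malgUZ; apply: leibniz_scale.
apply: leibnizC.
rewrite (monalgE f); apply: leibniz_sum => u; rewrite (malgUZ f@_u); apply: leibniz_scale.
by apply: leibnizC; apply: mon.
Qed.

End DifferentialPolynomials.

Section Homogeneous.
Context (k : fieldType) (d : Order.disp_t) (X : orderType d).
Implicit Types (f g : dpoly k X) (w : word X) (a c : k) (n m : int).

Definition homog n : {pred dpoly k X} :=
  fun f => all (fun w => wt w == n) (msupp f).

Lemma homogP n f :
  reflect (forall w, w \in msupp f -> wt w = n) (f \in homog n).
Proof. by apply: (iffP allP) => h w /h /eqP. Qed.

Lemma homog0 n : 0 \in homog n.
Proof. by apply/homogP => w; rewrite msupp0. Qed.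

Lemma homogD n f g : f \in homog n -> g \in homog n -> f + g \in homog n.
Proof.
move=> /homogP hf /homogP hg; apply/homogP => w /(fsubsetP (msuppD_le _ _)).
by rewrite in_fsetU => /orP[/hf|/hg].
Qed.

Lemma homogZ n c f : f \in homog n -> c *: f \in homog n.
Proof.
by move=> /homogP hf; apply/homogP => w /(fsubsetP (msuppZ_le _ _)) /hf.
Qed.

Lemma homog_sum n (I : eqType) (r : seq I) (F : I -> dpoly k X) :
  (forall i, i \in r -> F i \in homog n) -> \sum_(i <- r) F i \in homog n.
Proof.
move=> h; rewrite big_seq; elim/big_rec: _ => [|i f ri hf]; first exact: homog0.
by apply: homogD => //; apply: h.
Qed.

Lemma homogU n w : wt w = n -> (<< w >> : dpoly k X) \in homog n.
Proof. by move=> hw; apply/homogP => v; rewrite msuppU1 in_fset1 => /eqP->. Qed.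

Lemma homogM n m f g : f \in homog n -> g \in homog m -> f * g \in homog (n + m).
Proof.
move=> /homogP hf /homogP hg; apply/homogP => w /msuppM_le[u [v [uf vg ->]]].
by rewrite wtM (hf _ uf) (hg _ vg).
Qed.

Lemma homog_dop n f : f \in homog n -> dop f \in homog (n + 1).
Proof.
move=> /homogP hf; rewrite dop.unlock; apply: homog_sum => w /hf wn.
apply: homogZ; rewrite dword.unlock; apply: homog_sum => l lw.
apply: homogZ; apply: homogU; rewrite wtM wt_letter -wn.
rewrite -[in RHS](divcm_letterK lw) wtM wt_letter /= intS; ring.
Qed.

End Homogeneous.

Section GDN.
Context (k : fieldType) (d : Order.disp_t) (X : orderType d).

Definition gdn_pred : {pred dpoly k X} := homog (-1).

Fact gdn_submod_closed : submod_closed gdn_pred.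
Proof.
by split=> [|c f g hf hg]; [apply: homog0 | apply: homogD => //; apply: homogZ].
Qed.
HB.instance Definition _ :=
  GRing.isSubmodClosed.Build k (dpoly k X) gdn_pred gdn_submod_closed.

Record gdn : predArgType :=
  Gdn { gdn_val : dpoly k X; gdn_valP : gdn_val \in gdn_pred }.
HB.instance Definition _ := [isSub for gdn_val].
HB.instance Definition _ := [Choice of gdn by <:].
HB.instance Definition _ := [SubChoice_isSubLmodule of gdn by <:].

Fact gdn_mul_subproof (f g : gdn) : dop (\val f) * \val g \in gdn_pred.
Proof.
by rewrite -[gdn_pred]/(homog (-1 + 1 + -1)) homogM ?homog_dop ?(valP f) ?(valP g).
Qed.

Definition gdn_mul (f g : gdn) : gdn := Gdn (gdn_mul_subproof f g).

(* Junk value 0 when wt w <> -1. *)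
Definition gdn_word (w : word X) : gdn := insubd 0 << w >>.

End GDN.
Arguments gdn_pred {k d X} _ : simpl never.

Section LmodQuotient.
Context (k : pzRingType) (V : lmodType k).

(* No decidability is assumed: membership is turned into a boolean predicate
   classically, as the quotients of ring_quotient require. *)
Record submodule := Submodule {
  submod_set : set V;
  submod0 : submod_set 0;
  submodP : forall (c : k) (x y : V),
    submod_set x -> submod_set y -> submod_set (c *: x + y)
}.

Context (I : submodule).

Definition submod_pred : {pred V} := fun x => `[< submod_set I x >].

Fact submod_pred_closed : submod_closed submod_pred.
Proof.
split=> [|c x y /asboolP Ix /asboolP Iy]; apply/asboolP; first exact: submod0.
exact: submodP.
Qed.
HB.instance Definition _ :=
  GRing.isSubmodClosed.Build k V submod_pred submod_pred_closed.

Definition lquot := @Quotient.quot V submod_pred.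
HB.instance Definition _ := Choice.on lquot.
HB.instance Definition _ := ZmodQuotient.on lquot.

Definition lquot_scale (a : k) := lift_op1 lquot ( *:%R a).

Lemma pi_lquot_scale a : {morph \pi_lquot : x / a *: x >-> lquot_scale a x}.
Proof.
move=> x; unlock lquot_scale; apply/eqP; rewrite piE Quotient.equivE.
by rewrite -scalerBr rpredZ // Quotient.idealrBE reprK.
Qed.

Fact lquot_scaleA a b x :
  lquot_scale a (lquot_scale b x) = lquot_scale (a * b) x.
Proof. by rewrite -[x]reprK -!pi_lquot_scale scalerA. Qed.

Fact lquot_scale1 : left_id 1 lquot_scale.
Proof. by move=> x; rewrite -[x]reprK -pi_lquot_scale scale1r. Qed.

Fact lquot_scaleDr : right_distributive lquot_scale +%R.
Proof.
move=> a x y; rewrite -[x]reprK -[y]reprK -!pi_lquot_scale.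
by rewrite -raddfD -pi_lquot_scale scalerDr raddfD.
Qed.

Fact lquot_scaleDl x : {morph lquot_scale^~ x : a b / a + b}.
Proof.
by move=> a b; rewrite -[x]reprK -!pi_lquot_scale scalerDl raddfD.
Qed.

HB.instance Definition _ := GRing.Zmodule_isLmodule.Build k lquot
  lquot_scaleA lquot_scale1 lquot_scaleDr lquot_scaleDl.

HB.instance Definition _ := GRing.isScalable.Build k V lquot _ \pi_lquot
  pi_lquot_scale.

Lemma lquot_eqP (x y : V) : \pi_lquot x = \pi_lquot y <-> submod_set I (x - y).
Proof.
split=> [/eqP|h]; first by rewrite -Quotient.idealrBE => /asboolP.
by apply/eqP; rewrite -Quotient.idealrBE; apply/asboolP.
Qed.

End LmodQuotient.

Section GDNPresented.
Context (k : fieldType) (d : Order.disp_t) (X : orderType d).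
Implicit Types (f g : gdn k X).

Definition gdn_ideal_closed (I : set (gdn k X)) : Prop :=
  [/\ I 0,
      forall (c : k) f g, I f -> I g -> I (c *: f + g),
      forall f g, I f -> I (gdn_mul f g) &
      forall f g, I g -> I (gdn_mul f g)].

Definition gdn_ideal (S : set (gdn k X)) : set (gdn k X) :=
  smallest gdn_ideal_closed S.

Context (S : set (gdn k X)).

Fact gdn_ideal_idealP : gdn_ideal_closed (gdn_ideal S).
Proof.
split=> [I [[]] // | c f g hf hg I hI | f g hf I hI | f g hg I hI].
- by case: (hI.1) => _ + _ _; apply; [apply: hf | apply: hg].
- by case: (hI.1) => _ _ + _; apply; apply: hf.
- by case: (hI.1) => _ _ _; apply; apply: hg.
Qed.

Definition gdn_ideal_submod : submodule (gdn k X) :=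
  Submodule (let: And4 I0 _ _ _ := gdn_ideal_idealP in I0)
    (let: And4 _ IL _ _ := gdn_ideal_idealP in IL).

End GDNPresented.

(* GDN(X|S) *)
Notation gdn_quot S := (lquot (gdn_ideal_submod S)).

Section GDNQuotientProduct.
Context (k : fieldType) (d : Order.disp_t) (X : orderType d).
Context (S : set (gdn k X)).
Implicit Types (f g : gdn k X).

Definition gdn_quot_mul := lift_op2 (gdn_quot S) (@gdn_mul k d X).

Lemma gdn_mulBr f g h : gdn_mul f (g - h) = gdn_mul f g - gdn_mul f h.
Proof. by apply/val_inj; rewrite /= mulrBr. Qed.

Lemma gdn_mulBl f g h : gdn_mul (f - g) h = gdn_mul f h - gdn_mul g h.
Proof.
apply/val_inj; rewrite /= -mulrBl; congr (_ * _).
exact: (linearB (@dop k d X)).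
Qed.

Lemma pi_gdn_quot_mul :
  {morph \pi_(gdn_quot S) : f g / gdn_mul f g >-> gdn_quot_mul f g}.
Proof.
move=> f g; unlock gdn_quot_mul; apply/lquot_eqP.
set f' := repr _; set g' := repr _.
have [_ IL Ir Il] := gdn_ideal_idealP S.
have -> : gdn_mul f g - gdn_mul f' g' =
    1 *: gdn_mul f (g - g') + gdn_mul (f - f') g'.
  by rewrite gdn_mulBr gdn_mulBl scale1r addrA subrK.
apply: IL; [apply: Il|apply: Ir]; apply/(@lquot_eqP _ _ (gdn_ideal_submod S)).
- by rewrite reprK.
- by rewrite reprK.
Qed.

End GDNQuotientProduct.

Section DifferentialQuotient.
Context (k : fieldType) (d : Order.disp_t) (X : orderType d).
Implicit Types (f g : dpoly k X).

Definition diff_ideal_closed (I : set (dpoly k X)) : Prop :=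
  [/\ I 0,
      forall (c : k) f g, I f -> I g -> I (c *: f + g),
      forall f g, I g -> I (f * g) &
      forall f, I f -> I (dop f)].

Definition diff_ideal (S : set (dpoly k X)) : set (dpoly k X) :=
  smallest diff_ideal_closed S.

Context (S : set (dpoly k X)).

Fact diff_ideal_idealP : diff_ideal_closed (diff_ideal S).
Proof.
split=> [I [[]] // | c f g hf hg I hI | f g hg I hI | f hf I hI].
- by case: (hI.1) => _ + _ _; apply; [apply: hf | apply: hg].
- by case: (hI.1) => _ _ + _; apply; apply: hg.
- by case: (hI.1) => _ _ _; apply; apply: hf.
Qed.

Definition diff_ideal_submod : submodule (dpoly k X) :=
  Submodule (let: And4 I0 _ _ _ := diff_ideal_idealP in I0)
    (let: And4 _ IL _ _ := diff_ideal_idealP in IL).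

Local Notation Q := (lquot diff_ideal_submod).

Definition dquot_mul := lift_op2 Q ( *%R : dpoly k X -> _ -> _).
Definition dquot_dop := lift_op1 Q (@dop k d X).

Lemma pi_dquot_mul : {morph \pi_Q : f g / f * g >-> dquot_mul f g}.
Proof.
move=> f g; unlock dquot_mul; apply/lquot_eqP.
set f' := repr _; set g' := repr _.
have [_ IL Il _] := diff_ideal_idealP.
have -> : f * g - f' * g' = 1 *: (f * (g - g')) + g' * (f - f').
  by rewrite scale1r !mulrBr addrA [g' * f]mulrC subrK [g' * f']mulrC.
apply: IL; apply: Il; apply/(@lquot_eqP _ _ diff_ideal_submod).
- by rewrite reprK.
- by rewrite reprK.
Qed.

Lemma pi_dquot_dop : {morph \pi_Q : f / dop f >-> dquot_dop f}.
Proof.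
move=> f; unlock dquot_dop; apply/lquot_eqP.
have [_ _ _ ID] := diff_ideal_idealP.
rewrite /= -(linearB (@dop k d X)); apply: ID.
by apply/(@lquot_eqP _ _ diff_ideal_submod); rewrite reprK.
Qed.

Fact dquot_mulA : associative dquot_mul.
Proof.
move=> x y z; rewrite -[x]reprK -[y]reprK -[z]reprK.
by rewrite -!pi_dquot_mul mulrA.
Qed.

Fact dquot_mulC : commutative dquot_mul.
Proof.
by move=> x y; rewrite -[x]reprK -[y]reprK -!pi_dquot_mul mulrC.
Qed.

Fact dquot_mul1 : left_id (\pi_Q 1) dquot_mul.
Proof. by move=> x; rewrite -[x]reprK -pi_dquot_mul mul1r. Qed.

Fact dquot_mulDl : left_distributive dquot_mul +%R.
Proof.
move=> x y z; rewrite -[x]reprK -[y]reprK -[z]reprK.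
by rewrite -raddfD -!pi_dquot_mul mulrDl raddfD.
Qed.

HB.instance Definition _ := GRing.Zmodule_isComPzRing.Build Q
  dquot_mulA dquot_mulC dquot_mul1 dquot_mulDl.

Fact dquot_dop_is_linear : linear (dquot_dop : Q -> Q).
Proof.
move=> c x y; rewrite -[x]reprK -[y]reprK.
rewrite -(linearP \pi_Q) -!pi_dquot_dop (linearP (@dop k d X)).
exact: (linearP \pi_Q).
Qed.
HB.instance Definition _ := GRing.isLinear.Build k Q Q _
  dquot_dop dquot_dop_is_linear.

Lemma dquot_dopM (x y : Q) :
  dquot_dop (x * y) = dquot_dop x * y + x * dquot_dop y.
Proof.
rewrite -[x]reprK -[y]reprK -!pi_dquot_dop.
rewrite -[_ * _ in LHS]pi_dquot_mul -pi_dquot_dop dopM.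
by rewrite raddfD; congr (_ + _); apply: pi_dquot_mul.
Qed.

End DifferentialQuotient.

(* k{X|S}; the ring structure is possibly trivial, as S is arbitrary here. *)
Notation dquot S := (lquot (diff_ideal_submod S)).

Section LinearAlgebra.
Context (k : fieldType) (V : lmodType k).

Definition lin_span (G : set V) : set V :=
  [set x | exists n (c : 'I_n -> k) (v : 'I_n -> V),
     (forall i, G (v i)) /\ x = \sum_(i < n) c i *: v i].

(* The family (v i)_(i in B); linear independence makes v injective on B. *)
Definition lin_basis (I : eqType) (B : set I) (v : I -> V) : Prop :=
  lin_span (v @` B) = setT /\
  forall (r : seq I) (c : I -> k), uniq r -> (forall i, i \in r -> B i) ->
    \sum_(i <- r) c i *: v i = 0 -> forall i, i \in r -> c i = 0.

End LinearAlgebra.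

Definition gdn_embedding (k : fieldType) (A B : lmodType k)
    (mulA : A -> A -> A) (mulB : B -> B -> B) (phi : A -> B) : Prop :=
  [/\ linear phi, {morph phi : x y / mulA x y >-> mulB x y} & injective phi].

Section GroebnerShirshov.
Context (k : fieldType) (d : Order.disp_t) (X : orderType d).
Implicit Types (S T : set (dpoly k X)) (f g h p q s : dpoly k X).
Implicit Types (u v w : word X) (t m : nat).

Definition dopn t f : dpoly k X := iter t dop f.

(* u and v are the cofactors of the leading words of p and q. *)
Definition composition_of p q u v : dpoly k X :=
  (lc p)^-1 *: (<< u >> * p) - (lc q)^-1 *: (<< v >> * q).

(* composition ovl S w h: h is the composition of D^t1 f and D^t2 g at the
   common multiple w, for some f, g in S; ovl tells which w are admitted. *)
Variant composition (ovl : word X -> word X -> word X -> Prop) S w :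
    dpoly k X -> Prop :=
  Composition f g t1 t2 u1 u2 of
    S f & S g &
    dopn t1 f <> 0 & dopn t2 g <> 0 &
    w = (u1 * lead (dopn t1 f))%M & w = (u2 * lead (dopn t2 g))%M &
    ovl (lead (dopn t1 f)) (lead (dopn t2 g)) w :
    composition ovl S w (composition_of (dopn t1 f) (dopn t2 g) u1 u2).

Definition nontrivial_lcm u v w : Prop :=
  w = lcm_word u v /\ (mdeg w < mdeg u + mdeg v)%N.

Definition trivial S w h : Prop :=
  lin_span [set p | exists u t s,
    [/\ S s, dopn t s <> 0, p = << u >> * dopn t s & (lead p < w)%O]] h.

Definition irr S : set (word X) :=
  [set w | forall u t s,
     S s -> dopn t s <> 0 -> w <> (u * lead (dopn t s))%M].

(* Stage n + 1 adds all compositions of stage n that are non-trivial with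
   respect to stage n. *)
Fixpoint buchberger_stage S n : set (dpoly k X) :=
  if n is n'.+1 then
    let S' := buchberger_stage S n' in
    S' `|` [set h | exists2 w, composition nontrivial_lcm S' w h &
                               ~ trivial S' w h]
  else S.

Definition buchberger_shirshov S : set (dpoly k X) :=
  \bigcup_n buchberger_stage S n.

Definition nontrivial_common_multiple u v w : Prop :=
  wt w = -1 /\ ~ (exists w', w = (u * v * w')%M).

Definition gdn_trivial T w h : Prop :=
  lin_span [set p | exists u t s,
    [/\ T s, dopn t s <> 0, p = << u >> * dopn t s,
        wt (lead p) = -1 & (lead p < w)%O]] h.

Definition gdn_gs_basis T : Prop :=
  T `<=` [set f | f \in gdn_pred] /\
  forall w h, composition nontrivial_common_multiple T w h ->
              gdn_trivial T w h.

Definition gdn_irr T : set (word X) :=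
  [set w | wt w = -1 /\ forall u t s,
     T s -> dopn t s <> 0 -> w <> (u * lead (dopn t s))%M].

End GroebnerShirshov.

(* Main.v *)
Require Import Defs.
From HB Require Import structures.
From mathcomp Require Import all_boot all_order all_algebra.
From mathcomp Require Import finmap zify boolp classical_sets.
From mathcomp.multinomials Require Import monalg.
Set Implicit Arguments.
Unset Strict Implicit.
Unset Printing Implicit Defensive.
Import Order.TTheory GRing.Theory Num.Theory.
Local Open Scope ring_scope.
Local Open Scope classical_set_scope.
Local Open Scope quotient_scope.

(** Commutative Buchberger theory applied to the derivatives of S^c shows that
    the leading word of any nonzero element of Id[S] is a multiple of some
    lead (D^t s), s in S^c.  The completion consists of homogeneous elements, so
    dividing an element of weight -1 only involves multiples u D^t s of weight
    -1, that is elements of S'; this gives the Groebner-Shirshov property of S'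
    and the spanning and independence of Irr(S') modulo Id[S].

    It remains to see that Id[S] meets GDN(X) exactly in the ideal Id(S).  The
    intersection is spanned by the u D^t s with s in S and wt u = -t.  Such a u
    is a product of groups b_1 ... b_i a[i], i >= 0, of weight 0 and of t letters
    of weight -1, and multiplication by the former as well as the operation
    s |-> b_1 ... b_t D^t s preserve Id(S): by the Leibniz rule,
    b_0 ... b_t D y = D (b_1 ... b_t y) b_0 - D (b_1 ... b_t) (b_0 y), where the
    first term is a product in GDN(X) and the second is a sum of products
    D b_i * (b_0 ... b_t y / b_i), so induction on t applies. *)

(** * Well-foundedness of lexicographic orders *)

Lemma wf_prodlexi (d1 d2 : Order.disp_t) (T1 : orderType d1) (T2 : orderType d2) :
  well_founded (fun a b : T1 => (a < b)%O) ->
  well_founded (fun a b : T2 => (a < b)%O) ->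
  well_founded (fun a b : (T1 *l T2)%type => (a < b)%O).
Proof.
move=> wf1 wf2 [x y]; elim/(well_founded_ind wf1): x y => x IHx y.
elim/(well_founded_ind wf2): y => y IHy.
constructor=> -[x' y'].
rewrite ltEprodlexi /= => /andP[xx' /implyP xy].
have [x'x|xx] := ltP x' x; first exact: IHx.
have <- : x = x' by apply/le_anti; rewrite xx xx'.
by apply: IHy; apply: xy.
Qed.

(** Sequences of unbounded length admit infinite lexicographic descents, hence the restriction to
    equal sizes. The induction is on the length, then on the head, then on the accessibility of the
    tail. *)
Lemma wf_seqlexi (d : Order.disp_t) (T : orderType d) :
  well_founded (fun a b : T => (a < b)%O) ->
  well_founded (fun s t : seqlexi T => size s = size t /\ (s < t)%O).
Proof.
move=> wfT s; have [n] := ubnP (size s).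
elim: n s => [s|n IHn [|x s] /= sn]; first by rewrite ltn0.
  by constructor=> t [_]; rewrite ltxis0; move/notF.
elim/(well_founded_ind wfT): x s sn => x IHx s sn.
have accs : Acc (fun s t : seqlexi T => size s = size t /\ (s < t)%O) s.
  exact: IHn.
elim: accs sn => {}s _ IHs sn.
constructor=> -[|y u] []; first by discriminate.
case=> us; rewrite ltxi_cons => /andP[yx /implyP ut].
have [y'x|xy] := ltP y x; first by apply: IHx => //; rewrite us.
have -> : y = x by apply/le_anti; rewrite xy yx.
by apply: IHs; [split=> //; apply: ut | rewrite us].
Qed.

(** * The order on words is a monomial well order *)

Section WordOrder.
Context (d : Order.disp_t) (X : orderType d).
Implicit Types (u v w : word X) (l : letter X).

Lemma size_letters w : size (letters w) = mdeg w.
Proof.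
rewrite /letters size_flatten /shape -map_comp sumnE big_map mdegE.
by apply: eq_bigr => l _; rewrite /= size_nseq.
Qed.

(** The witness is the entry of [t] at the first place where the two sequences differ. Both are
    decreasing, so beyond that place no entry exceeds it and those of [s] are even strictly
    smaller. *)
Lemma ltxi_sorted_count (s t : seqlexi (letter X)) :
  sorted >=%O (s : seq (letter X)) -> sorted >=%O (t : seq (letter X)) ->
  (s < t)%O -> exists l, (count_mem l s < count_mem l t)%N /\
     forall j, (l < j)%O -> count_mem j s = count_mem j t.
Proof.
have ge_trans : transitive (>=%O : rel (letter X)).
  by move=> y x z xy yz; apply: le_trans yz xy.
have zero (s0 : seq (letter X)) x j :
    all (>=%O x) s0 -> (x < j)%O -> count_mem j s0 = 0%N.
  move=> /allP h xj; apply/count_memPn/negP => /h /= jx.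
  by move: (lt_le_trans xj jx); rewrite ltxx.
elim: s t => [|x s IH] [|y t] //=.
- move=> _ pt _; exists y; rewrite eqxx; split=> // j yj.
  have := zero t y j; rewrite (lt_eqF yj) => -> //.
  exact: (order_path_min ge_trans pt).
- move=> ps pt; rewrite ltxi_cons => /andP[xy /implyP st].
  have [y_le_x|x_lt_y] := leP y x.
    have -> : x = y by apply/le_anti; rewrite xy.
    have [|||l [ls lj]] := IH t; rewrite ?(path_sorted ps) ?(path_sorted pt) ?st //.
    by exists l; rewrite ltn_add2l; split=> // j /lj ->.
  have sx := order_path_min ge_trans ps.
  have ty := order_path_min ge_trans pt.
  exists y; rewrite eqxx (lt_eqF x_lt_y) (zero _ _ _ sx x_lt_y); split=> // j yj.
  have xj := lt_trans x_lt_y yj.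
  by rewrite (lt_eqF yj) (lt_eqF xj) (zero s x) // (zero t y).
Qed.

Lemma lt_wordE u v : (u < v)%O = (ord u < ord v)%O.
Proof. by rewrite !lt_leAnge. Qed.

Lemma lt_wordP u v : (u < v)%O <->
  (mdeg u < mdeg v)%N \/
  (mdeg u = mdeg v /\
   exists l, (u l < v l)%N /\ forall j, (l < j)%O -> u j = v j).
Proof.
have fwd (u' v' : word X) : (u' < v')%O -> (mdeg u' < mdeg v')%N \/
    (mdeg u' = mdeg v' /\
     exists l, (u' l < v' l)%N /\ forall j, (l < j)%O -> u' j = v' j).
  rewrite lt_wordE ltEprodlexi /= => /andP[uv /implyP h].
  have [|vu] := ltP (mdeg u') (mdeg v'); first by left.
  right; split; first by apply/le_anti; rewrite uv.
  have sort_ge (s : seq (letter X)) : sorted >=%O (sort >=%O s).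
    by apply: sort_sorted => x y; apply: le_total.
  have [l [ll lj]] := ltxi_sorted_count (sort_ge _) (sort_ge _) (h vu).
  exists l; move: ll; rewrite !count_sort !count_letters; split=> // j /lj.
  by rewrite !count_sort !count_letters.
(* The converse follows from totality: if [v < u] held, the forward direction would give a second
   topmost letter of disagreement, with the opposite inequality. *)
split; first exact: fwd.
move=> h; case: (ltgtP u v) => // [/fwd h'|uv]; last first.
  by move: h; rewrite uv => -[|[_ [l [+ _]]]]; rewrite ltnn.
case: h => [uv|[uv [l [ll lj]]]].
  by case: h' => [|[]]; lia.
case: h' => [|[_ [m [mm mj]]]]; first by lia.
case: (ltgtP l m) => [/lj|/mj|lm]; [by lia|by lia|].
by move: ll mm; rewrite lm; lia.
Qed.

Lemma lt_mulw w u v : (u < v)%O -> ((w * u)%M < (w * v)%M)%O.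
Proof.
move=> /lt_wordP h; apply/lt_wordP; rewrite !mdegM ltn_add2l.
case: h => [|[uv [l [ll lj]]]]; first by left.
right; rewrite uv; split=> //; exists l; rewrite !cmM ltn_add2l; split=> // j.
by rewrite !cmM => /lj ->.
Qed.

Lemma le1w w : ((1%M : word X) <= w)%O.
Proof.
have [->|wN1] := eqVneq w 1%M; first exact: lexx.
apply/ltW/lt_wordP; left; rewrite mdeg1 lt0n.
by apply: contraNneq wN1 => /mdeg_eq0I ->.
Qed.

(** The outer induction on the degree absorbs every descent that lowers it; the remaining descents
    compare sorted letter sequences of one fixed length, where [wf_seqlexi] applies. *)
Lemma wf_word : well_founded (fun a b : X => (a < b)%O) ->
  well_founded (fun u v : word X => (u < v)%O).
Proof.
move=> wfX; have wfN : well_founded (fun a b : nat => (a < b)%O).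
  by elim/ltn_ind=> n IHn; constructor=> m; apply: IHn.
have wfL := wf_seqlexi (wf_prodlexi wfN wfX).
move=> w; have [n] := ubnP (mdeg w).
elim: n w => [w|n IHn w wn]; first by rewrite ltn0.
move: {2}(ord w).2 (erefl (ord w).2) => s ws.
elim/(well_founded_ind wfL): s w ws wn => s IHs w ws wn.
constructor=> v; rewrite lt_wordE ltEprodlexi /= => /andP[vw /implyP h].
have [|wv] := ltP (mdeg v) (mdeg w).
  by move=> vw'; apply: IHn; apply: leq_trans vw' _.
apply: (IHs (ord v).2 _ v) => //; last by apply: leq_ltn_trans vw wn.
rewrite -ws; split; last exact: h.
by rewrite /= !size_sort !size_letters; apply/le_anti; rewrite vw.
Qed.

End WordOrder.

(** * Linear spans and induction on them *)

Section LinearSpan.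
Context (k : fieldType) (V : lmodType k).
Implicit Types (G : set V) (x y : V) (c : k).

Lemma lin_span0 G : lin_span G 0.
Proof.
exists 0%N, (fun=> 0), (fun=> 0); split; first by case.
by rewrite big_ord0.
Qed.

Lemma lin_span_cons G c x y : G x -> lin_span G y -> lin_span G (c *: x + y).
Proof.
move=> Gx [n [a [v [Gv ->]]]].
exists n.+1, (fun i => if unlift ord0 i is Some j then a j else c),
  (fun i => if unlift ord0 i is Some j then v j else x); split=> [i|].
  by case: (unlift ord0 i).
rewrite big_ord_recl /= unlift_none; congr (_ + _).
by apply: eq_bigr => i _; rewrite liftK.
Qed.

Lemma lin_span_rec G (P : V -> Prop) : P 0 ->
  (forall c x y, G x -> lin_span G y -> P y -> P (c *: x + y)) ->
  forall x, lin_span G x -> P x.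
Proof.
move=> P0 PS x [n [a [v [Gv ->]]]].
suff [] : lin_span G (\sum_(i < n) a i *: v i) /\ P (\sum_(i < n) a i *: v i) by [].
elim/big_rec: _ => [|i y _ [Gy Py]]; first by split=> //; apply: lin_span0.
by split; [apply: lin_span_cons|apply: PS].
Qed.

Lemma lin_span_gen G x : G x -> lin_span G x.
Proof.
move=> Gx; rewrite -[x]addr0 -[x]scale1r.
exact/lin_span_cons/lin_span0.
Qed.

Lemma lin_spanP G c x y :
  lin_span G x -> lin_span G y -> lin_span G (c *: x + y).
Proof.
move=> + Gy; elim/lin_span_rec: x / => [|a x z Gx _ IH].
  by rewrite scaler0 add0r.
by rewrite scalerDr -addrA scalerA; apply: lin_span_cons.
Qed.

Lemma lin_spanZ G c x : lin_span G x -> lin_span G (c *: x).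
Proof. by move=> Gx; rewrite -[_ *: _]addr0; apply/lin_spanP/lin_span0. Qed.

Lemma lin_spanD G x y : lin_span G x -> lin_span G y -> lin_span G (x + y).
Proof. by move=> Gx Gy; rewrite -[x]scale1r; apply: lin_spanP. Qed.

Lemma lin_spanB G x y : lin_span G x -> lin_span G y -> lin_span G (x - y).
Proof. by move=> Gx Gy; rewrite addrC -scaleN1r; apply: lin_spanP. Qed.

Lemma lin_span_sub G (P : V -> Prop) : P 0 ->
  (forall c x y, P x -> P y -> P (c *: x + y)) -> G `<=` P -> lin_span G `<=` P.
Proof.
move=> P0 PL GP; apply: lin_span_rec => // c x y Gx _.
exact/PL/GP.
Qed.

Lemma lin_span_trans G H : G `<=` lin_span H -> lin_span G `<=` lin_span H.
Proof. by apply: lin_span_sub; [exact: lin_span0|move=> *; exact: lin_spanP]. Qed.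

Lemma lin_spanS G H : G `<=` H -> lin_span G `<=` lin_span H.
Proof. by move=> GH; apply: lin_span_trans => x /GH /lin_span_gen. Qed.

End LinearSpan.

Lemma lin_span_image (k : fieldType) (U V : lmodType k) (f : {linear U -> V})
    (G : set U) (H : set V) :
  (forall x, G x -> lin_span H (f x)) -> forall x, lin_span G x -> lin_span H (f x).
Proof.
move=> GH; apply: lin_span_rec => [|c x y Gx _ Hy].
  by rewrite raddf0; apply: lin_span0.
by rewrite linearP; apply: lin_spanP => //; apply: GH.
Qed.

(** * Divisibility and least common multiples of words *)

Section WordDivisibility.
Context (d : Order.disp_t) (X : orderType d).
Implicit Types (a b c u v w : word X) (l : letter X).

Lemma mulwI w u v : (u * w)%M = (v * w)%M -> u = v.
Proof.
move=> uv; apply/eqP/cmP => l; apply: (@addIn (w l)).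
by rewrite -!cmM uv.
Qed.

Lemma lcm_wordE u v l : lcm_word u v l = maxn (u l) (v l).
Proof.
rewrite /lcm_word cmE /= fsfunE in_fsetU; case: (mdomP u l) => // _.
by case: (mdomP v l).
Qed.

Lemma dvdwP u w : (forall l, (u l <= w l)%N) <-> exists a, w = (a * u)%M.
Proof.
split=> [h|[a ->] l]; last by rewrite cmM leq_addl.
exists (divcm w u); apply/eqP/cmP => l.
by rewrite cmM divcmE subnK.
Qed.

Lemma lcm_wordP a b u v w : w = (a * u)%M -> w = (b * v)%M ->
  exists c, w = (c * lcm_word u v)%M.
Proof.
move=> wu wv; apply/dvdwP => l; rewrite lcm_wordE geq_max.
by rewrite {1}wu wv !cmM !leq_addl.
Qed.

Lemma lcm_wordl u v : exists a, lcm_word u v = (a * u)%M.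
Proof. by apply/dvdwP => l; rewrite lcm_wordE leq_maxl. Qed.

Lemma lcm_wordr u v : exists a, lcm_word u v = (a * v)%M.
Proof. by apply/dvdwP => l; rewrite lcm_wordE leq_maxr. Qed.

Lemma lcm_word_coprime u v : (mdeg u + mdeg v <= mdeg (lcm_word u v))%N ->
  lcm_word u v = (u * v)%M.
Proof.
have [c uv] := lcm_wordP (mulmC u v) (erefl (u * v)%M).
rewrite -mdegM uv mdegM => h.
have -> : c = 1%M by apply: mdeg_eq0I; lia.
by rewrite mul1m.
Qed.

End WordDivisibility.

(** * Buchberger's criterion, from axioms for leading words in a commutative algebra *)

Record leading_structure (k : fieldType) (A : comAlgType k)
    (d : Order.disp_t) (X : orderType d) := LeadingStructure {
  mon : word X -> A;
  ldw : A -> word X;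
  ldc : A -> k;
  monM : forall u v, mon (u * v)%M = mon u * mon v;
  monM_neq0 : forall u p, p <> 0 -> mon u * p <> 0;
  ldw_monM : forall u p, p <> 0 -> ldw (mon u * p) = (u * ldw p)%M;
  ldc_monM : forall u p, p <> 0 -> ldc (mon u * p) = ldc p;
  ldc_neq0 : forall p, p <> 0 -> ldc p != 0;
  ldw_tail : forall p, p <> 0 -> exists2 r,
    lin_span [set mon v | v in [set v | (v < ldw p)%O]] r &
    p = ldc p *: mon (ldw p) + r;
  ldw_lt : forall w p, p <> 0 -> (ldw p < w)%O <->
    lin_span [set mon v | v in [set v | (v < w)%O]] p;
  ldw_add : forall c p q, c != 0 -> p <> 0 ->
    lin_span [set mon v | v in [set v | (v < ldw p)%O]] q ->
    c *: p + q <> 0 /\ ldw (c *: p + q) = ldw p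
}.

Section Buchberger.
Context (k : fieldType) (A : comAlgType k) (d : Order.disp_t) (X : orderType d).
Context (L : leading_structure A X).
Implicit Types (p q f g : A) (u v w a : word X) (G : set A).
Local Notation mon := (mon L).
Local Notation lead := (ldw L).
Local Notation lc := (ldc L).

Definition multiples G (P : set (word X)) : set A :=
  [set p | exists u g, [/\ G g, p = mon u * g & P (lead p)]].

Definition span_below G w : set A := lin_span (multiples G [set v | (v < w)%O]).

Definition s_poly p q u v : A := (lc p)^-1 *: (mon u * p) - (lc q)^-1 *: (mon v * q).

(** The hypothesis of Buchberger's criterion, demanded only at least common multiples of non-coprime
    leading words; [s_poly_span] extends it to all common multiples. *)
Definition s_trivial G := forall p q u v w, G p -> G q ->
  nontrivial_lcm (lead p) (lead q) w ->
  w = (u * lead p)%M -> w = (v * lead q)%M -> span_below G w (s_poly p q u v).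

Context (G : set A) (GN0 : forall g, G g -> g <> 0).

Lemma span_below_monM a w f : span_below G w f -> span_below G (a * w)%M (mon a * f).
Proof.
move: f; apply: lin_span_rec => [|c x y [u [g [Gg -> uw]]] _ IH].
  by rewrite mulr0; apply: lin_span0.
rewrite mulrDr -scalerAr; apply: lin_span_cons => //.
have g0 := GN0 Gg.
exists (a * u)%M, g; split=> //; first by rewrite monM mulrA.
rewrite /= ldw_monM; last exact: monM_neq0.
exact: lt_mulw.
Qed.

Lemma span_below_lt w p : p <> 0 -> span_below G w p -> (lead p < w)%O.
Proof.
move=> p0 h; apply/ldw_lt => //; move: p h {p0}; apply: lin_span_trans.
move=> p [u [g [Gg pE pw]]]; apply/ldw_lt => //.
by rewrite pE; apply/monM_neq0/GN0.
Qed.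

Lemma span_below_tail p q r : G q ->
  lin_span [set mon v | v in [set v | (v < lead p)%O]] r ->
  span_below G (lead p * lead q)%M (r * q).
Proof.
move=> Gq; move: r; apply: lin_span_rec => [|c x y [v /= vp <-] _ IH].
  by rewrite mul0r; apply: lin_span0.
rewrite mulrDl -scalerAl; apply: lin_span_cons => //.
exists v, q; split=> //; rewrite ldw_monM; last exact: GN0.
by rewrite ![(_ * lead q)%M]mulmC; apply: lt_mulw.
Qed.

(* For monic p = lead p + r and q = lead q + s, the S-polynomial
   (lead q) p - (lead p) q equals r q - s p. *)
Lemma s_poly_coprime p q : G p -> G q ->
  span_below G (lead p * lead q)%M (s_poly p q (lead q) (lead p)).
Proof.
move=> Gp Gq; have [p0 q0] := (GN0 Gp, GN0 Gq).
have [cp cq] := (ldc_neq0 L p0, ldc_neq0 L q0).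
have [r rP pE] := ldw_tail L p0; have [s sP qE] := ldw_tail L q0.
have mp : mon (lead p) = (lc p)^-1 *: (p - r).
  by rewrite [X in X - _]pE addrK scalerA mulVf ?scale1r.
have mq : mon (lead q) = (lc q)^-1 *: (q - s).
  by rewrite [X in X - _]qE addrK scalerA mulVf ?scale1r.
have -> : s_poly p q (lead q) (lead p) =
    ((lc p)^-1 * (lc q)^-1) *: (r * q) - ((lc p)^-1 * (lc q)^-1) *: (s * p).
  rewrite /s_poly mp mq -!scalerAl !scalerA [(lc q)^-1 * _]mulrC -!scalerBr.
  congr (_ *: _); rewrite !mulrBl [q * p]mulrC opprB.
  by rewrite addrC addrA subrK.
apply: lin_spanB; apply: lin_spanZ; first exact: span_below_tail.
by rewrite mulmC; apply: span_below_tail.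
Qed.

(** A common multiple is [a] times the least one, and the S-polynomial is then multiplied by the
    same [a]. At the least common multiple itself, either the hypothesis applies or the leading
    words are coprime and [s_poly_coprime] does. *)
Lemma s_poly_span p q u v w : s_trivial G -> G p -> G q ->
  w = (u * lead p)%M -> w = (v * lead q)%M -> span_below G w (s_poly p q u v).
Proof.
move=> triv Gp Gq wp wq.
have [a wE] := lcm_wordP wp wq.
have [u' lp] := lcm_wordl (lead p) (lead q).
have [v' lq] := lcm_wordr (lead p) (lead q).
have uE : u = (a * u')%M by apply: (@mulwI _ _ (lead p)); rewrite -wp -mulmA -lp.
have vE : v = (a * v')%M by apply: (@mulwI _ _ (lead q)); rewrite -wq -mulmA -lq.
have -> : s_poly p q u v = mon a * s_poly p q u' v'.
  by rewrite /s_poly uE vE !monM mulrBr -!scalerAr !mulrA.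
rewrite wE; apply: span_below_monM.
have [lt|ge] := ltnP (mdeg (lcm_word (lead p) (lead q)))
  (mdeg (lead p) + mdeg (lead q)).
  exact: triv.
have lE := lcm_word_coprime ge.
have -> : u' = lead q by apply: (@mulwI _ _ (lead p)); rewrite -lp lE mulmC.
have -> : v' = lead p by apply: (@mulwI _ _ (lead q)); rewrite -lq lE.
by rewrite lE; apply: s_poly_coprime.
Qed.

Lemma multiples_max P f : lin_span (multiples G P) f -> f <> 0 ->
  exists2 w, P w & lin_span (multiples G [set v | (v <= w)%O]) f.
Proof.
move=> fw f0.
suff [//|//] : f = 0 \/ exists2 w, P w & lin_span (multiples G [set v | (v <= w)%O]) f.
move: f fw {f0}; apply: lin_span_rec => [|c x y [u [g [Gg xE Px]]] _ IH]; first by left.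
right; case: IH => [->|[w Pw yw]].
  exists (lead x) => //; apply: lin_span_cons; last exact: lin_span0.
  by exists u, g; split=> //=.
exists (Order.max w (lead x)); first by rewrite /Order.max; case: ifP.
apply: lin_span_cons; first by exists u, g; split; rewrite //= le_max lexx orbT.
apply: lin_spanS yw => p [u' [g' [Gg' pE pw]]].
by exists u', g'; split=> //=; rewrite le_max pw.
Qed.

(* Modulo multiples with smaller leading word, all multiples with leading word
   w are proportional, their S-polynomials being trivial. *)
Lemma multiples_top w f : s_trivial G ->
  lin_span (multiples G [set v | (v <= w)%O]) f ->
  span_below G w f \/ exists c u g (b : A), [/\ c != 0, G g, w = (u * lead g)%M,
    span_below G w b & f = c *: (mon u * g) + b].
Proof.
move=> triv; move: f; apply: lin_span_rec => [|c x y [u [g [Gg xE /= xw]]] _ IH].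
  by left; apply: lin_span0.
have [->|c0] := eqVneq c 0; first by rewrite scale0r add0r.
have [lt|ge] := ltP (lead x) w.
  have xB : span_below G w (c *: x) by apply/lin_spanZ/lin_span_gen; exists u, g.
  case: IH => [yB|[c' [u' [g' [b [c0' Gg' wE bB ->]]]]]].
    by left; apply: lin_spanD.
  right; exists c', u', g', (c *: x + b); split=> //; first exact: lin_spanD.
  by rewrite addrCA.
have {ge} xw : w = lead x by apply/le_anti; rewrite ge xw.
have wu : w = (u * lead g)%M by rewrite xw xE ldw_monM //; apply: GN0.
have gen c1 b : span_below G w b ->
    span_below G w (c1 *: x + b) \/
    exists c u g (b0 : A), [/\ c != 0, G g, w = (u * lead g)%M,
      span_below G w b0 & c1 *: x + b = c *: (mon u * g) + b0].
  move=> bB; have [->|c10] := eqVneq c1 0; first by left; rewrite scale0r add0r.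
  by right; exists c1, u, g, b; rewrite xE.
case: IH => [|[c' [u' [g' [b [c0' Gg' wE bB ->]]]]]]; first exact: gen.
have sB : span_below G w (s_poly g' g u' u) by apply: s_poly_span.
have cg' := ldc_neq0 L (GN0 Gg').
(* With [x = mon u * g], the S-polynomial expresses [mon u' * g'] as [ldc g'] times the sum of the
   S-polynomial and [x / ldc g]. This merges the two top multiples into one. *)
have -> : c *: x + (c' *: (mon u' * g') + b) =
    (c + c' * lc g' / lc g) *: x + ((c' * lc g') *: s_poly g' g u' u + b).
  rewrite /s_poly xE scalerDl scalerBr !scalerA mulfK //.
  by rewrite -addrA; congr (_ + _); rewrite addrA [X in _ = X + b]addrC subrK.
by apply: gen; apply: lin_spanP.
Qed.

(** Well-founded induction on a bound [w] for the leading words of the multiples in use. By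
    [multiples_top], either the multiples at [w] cancel and the bound drops, or a single multiple of
    leading word [w] survives and supplies the leading word of [f]. *)
Theorem lead_reducible : well_founded (fun u v : word X => (u < v)%O) ->
  s_trivial G -> forall f, lin_span (multiples G setT) f -> f <> 0 ->
  exists u g, G g /\ lead f = (u * lead g)%M.
Proof.
move=> wf triv.
suff main w f : lin_span (multiples G [set v | (v <= w)%O]) f -> f <> 0 ->
    exists u g, G g /\ lead f = (u * lead g)%M.
  by move=> f fG f0; have [w _ /main] := multiples_max fG f0; apply.
elim/(well_founded_ind wf): w f => w IH f fB f0.
have [fw|[c [u [g [b [c0 Gg wE bB fE]]]]]] := multiples_top triv fB.
  by have [w' w'w /(IH _ w'w)] := multiples_max fw f0; apply.
have g0 := GN0 Gg; have ug0 : mon u * g <> 0 by apply: monM_neq0.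
exists u, g; split=> //; rewrite fE -(ldw_monM L u g0).
case: (ldw_add (l := L) (q := b) c0 ug0) => [|_ //].
have [->|/eqP b0] := eqVneq b 0; first exact: lin_span0.
by apply/ldw_lt => //; rewrite ldw_monM // -wE; apply: span_below_lt.
Qed.

End Buchberger.

(** * Leading words of differential polynomials *)

Section LeadingWord.
Context (k : fieldType) (d : Order.disp_t) (X : orderType d).
Implicit Types (f g p q : dpoly k X) (u v w : word X) (c : k).

Lemma lead_max f v : v \in msupp f -> (v <= lead f)%O.
Proof. by move=> vf; exact: (le_bigmax_seq _ _ xpredT id vf isT). Qed.

Lemma lead_in f : f <> 0 -> lead f \in msupp f.
Proof.
move=> /eqP f0; have [v vf] : exists v, v \in msupp f.
  by apply/fset0Pn; rewrite msupp_eq0.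
have [lead1|//] : lead f = 1%M \/ lead f \in msupp f.
  rewrite /lead big_seq; elim/big_rec: _ => [|w y wf IH]; first by left.
  by rewrite /Order.max; case: ifP => _ //; right.
(* If the maximum is its initial value 1, the least word, then every word of the support equals 1,
   so 1 does lie in the support. *)
suff <- : v = lead f by [].
by apply/le_anti; rewrite (lead_max vf) lead1 le1w.
Qed.

Lemma leadE f w : w \in msupp f -> (forall v, v \in msupp f -> (v <= w)%O) ->
  lead f = w.
Proof.
move=> wf h; have f0 : f <> 0 by move=> f0; rewrite f0 msupp0 in wf.
by apply/le_anti; rewrite (lead_max wf) (h _ (lead_in f0)).
Qed.

Lemma mcoeff_monM u v f : (<< u >> * f)@_(u * v)%M = f@_v.
Proof.
rewrite (mcoeffMrw _ msuppU_le (fsubset_refl (msupp f))).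
transitivity (\sum_(w <- msupp f) f@_w *+ (w == v)).
  apply: eq_bigr => w _; rewrite big_seq_fset1 mcoeffUU mul1r.
  congr (_ *+ nat_of_bool _); apply/eqP/eqP => [|-> //].
  by rewrite ![(u * _)%M]mulmC => /mulwI.
case: msuppP => [vf|vf].
  rewrite (big_fsetD1 v) //= eqxx mulr1n big_seq big1 ?addr0 // => w.
  by rewrite in_fsetD1 => /andP[/negbTE-> _]; rewrite mulr0n.
rewrite big_seq big1 // => w wf; case: eqP => [wv|]; last by rewrite mulr0n.
by rewrite -wv wf in vf.
Qed.

Lemma msupp_monM u v f : (v \in msupp (<< u >> * f)) <->
  exists2 w, w \in msupp f & v = (u * w)%M.
Proof.
split=> [/msuppM_le[u' [w [+ wf ->]]]|[w wf ->]].
  by rewrite msuppU1 in_fset1 => /eqP->; exists w.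
by rewrite -mcoeff_neq0 mcoeff_monM mcoeff_neq0.
Qed.

Lemma lead_monM u f : f <> 0 -> lead (<< u >> * f) = (u * lead f)%M.
Proof.
move=> f0; apply: leadE.
  by apply/msupp_monM; exists (lead f) => //; apply: lead_in.
move=> v /msupp_monM[w /lead_max wf ->].
by move: wf; rewrite !le_eqVlt => /orP[/eqP->|/(lt_mulw u)->]; rewrite ?eqxx ?orbT.
Qed.

Lemma mon_mul_neq0 u f : f <> 0 -> << u >> * f <> 0.
Proof.
move=> /lead_in lf uf0; have : (u * lead f)%M \in msupp (<< u >> * f).
  by apply/msupp_monM; exists (lead f).
by rewrite uf0 msupp0.
Qed.

Lemma lc_monM u f : f <> 0 -> lc (<< u >> * f) = lc f.
Proof. by move=> f0; rewrite /lc lead_monM // mcoeff_monM. Qed.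

Lemma lc_neq0 f : f <> 0 -> lc f != 0.
Proof. by move=> /lead_in; rewrite mcoeff_neq0. Qed.

Lemma lin_span_mon (P : set (word X)) f :
  lin_span [set << v >> | v in P] f <-> forall v, v \in msupp f -> P v.
Proof.
split.
  move: f; apply: lin_span_rec => [|c x y [w Pw <-] _ IH] v; first by rewrite msupp0.
  move=> /(fsubsetP (msuppD_le _ _)); rewrite in_fsetU => /orP[|/IH //].
  by move=> /(fsubsetP (msuppZ_le _ _)); rewrite msuppU1 in_fset1 => /eqP->.
move=> h; rewrite (monalgE f) big_seq.
elim/big_rec: _ => [|v y vf IH]; first exact: lin_span0.
rewrite malgUZ; apply: lin_span_cons => //.
by exists v => //; apply: h.
Qed.

Lemma lead_lt w f : f <> 0 -> (lead f < w)%O <->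
  lin_span [set << v >> | v in [set v | (v < w)%O]] f.
Proof.
move=> f0; split=> [fw|/lin_span_mon h]; last exact/h/lead_in.
by apply/lin_span_mon => v /lead_max vf; apply: le_lt_trans vf fw.
Qed.

Lemma lead_tail f : f <> 0 -> exists2 r,
  lin_span [set << v >> | v in [set v | (v < lead f)%O]] r &
  f = lc f *: << lead f >> + r.
Proof.
move=> f0; exists (f - lc f *: << lead f >>); last by rewrite addrC subrK.
apply/lin_span_mon => v.
have [->|vl] := eqVneq v (lead f).
  by rewrite -mcoeff_neq0 mcoeffB mcoeffZ mcoeffUU mulr1 /lc subrr eqxx.
rewrite -mcoeff_neq0 mcoeffB mcoeffZ [X in _ * X]mcoeffU.
rewrite [lead f == v]eq_sym (negbTE vl) mulr0n mulr0 subr0 mcoeff_neq0 => /lead_max.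
by rewrite /= lt_neqAle vl.
Qed.

Lemma lead_add c p q : c != 0 -> p <> 0 ->
  lin_span [set << v >> | v in [set v | (v < lead p)%O]] q ->
  c *: p + q <> 0 /\ lead (c *: p + q) = lead p.
Proof.
move=> c0 p0 /lin_span_mon ql.
have lpq : lead p \in msupp (c *: p + q)%R.
  have lq : lead p \notin msupp q by apply/negP => /ql /=; rewrite ltxx.
  rewrite -mcoeff_neq0 mcoeffD mcoeffZ (mcoeff_outdom lq) addr0 mulf_neq0 //.
  exact: lc_neq0.
split; first by move=> h; rewrite h msupp0 in lpq.
apply: leadE => // v /(fsubsetP (msuppD_le _ _)).
rewrite in_fsetU => /orP[/(fsubsetP (msuppZ_le _ _)) /lead_max //|/ql].
exact: ltW.
Qed.

Definition dpoly_leading : leading_structure (dpoly k X) X :=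
  LeadingStructure (@malgUM k d X) mon_mul_neq0 lead_monM lc_monM lc_neq0
    lead_tail lead_lt lead_add.

End LeadingWord.

(** * Cancellation in S-polynomials and closure of the multiples under products *)

Section SPolyLead.
Context (k : fieldType) (A : comAlgType k) (d : Order.disp_t) (X : orderType d).
Context (L : leading_structure A X).

Lemma lin_span_monM u w (r : A) :
  lin_span [set mon L v | v in [set v | (v < w)%O]] r ->
  lin_span [set mon L v | v in [set v | (v < u * w)%M%O]] (mon L u * r).
Proof.
move: r; apply: lin_span_rec => [|c x y [v /= vw <-] _ IH].
  by rewrite mulr0; apply: lin_span0.
rewrite mulrDr -scalerAr -monM; apply: lin_span_cons => //.
by exists (u * v)%M => //; apply: lt_mulw.
Qed.

(** After normalization both terms have leading term [w] with coefficient 1, and these cancel. *)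
Lemma s_poly_below (p q : A) u v w : p <> 0 -> q <> 0 ->
  w = (u * ldw L p)%M -> w = (v * ldw L q)%M ->
  lin_span [set mon L v | v in [set v | (v < w)%O]] (s_poly L p q u v).
Proof.
suff tail (p' : A) u' : p' <> 0 -> w = (u' * ldw L p')%M ->
    exists2 r, lin_span [set mon L v | v in [set v | (v < w)%O]] r &
      (ldc L p')^-1 *: (mon L u' * p') = mon L w + r.
  move=> p0 q0 /(tail p u p0)[r rw pE] /(tail q v q0)[s sw qE].
  by rewrite /s_poly pE qE opprD addrACA subrr add0r; apply: lin_spanB.
move=> p0 wE; have [r rP pE] := ldw_tail L p0.
exists ((ldc L p')^-1 *: (mon L u' * r)).
  by apply: lin_spanZ; rewrite wE; apply: lin_span_monM.
rewrite {2}pE mulrDr -scalerAr -monM -wE scalerDr scalerA mulVf ?scale1r //.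
exact: ldc_neq0.
Qed.

Lemma multiples_mul (G : set A) (g h : A) : lin_span [set mon L v | v in setT] g ->
  lin_span (multiples L G setT) h -> lin_span (multiples L G setT) (g * h).
Proof.
move=> gM; move: h; apply: lin_span_rec => [|c x y [u [p [Sp -> _]]] _ IH].
  by rewrite mulr0; apply: lin_span0.
rewrite mulrDr; apply: (lin_spanD _ IH); rewrite -scalerAr; apply: lin_spanZ.
move: g gM {IH}; apply: lin_span_rec => [|a z t [v _ <-] _ IH].
  by rewrite mul0r; apply: lin_span0.
rewrite mulrDl -scalerAl; apply: lin_span_cons => //.
by exists (v * u)%M, p; rewrite monM mulrA.
Qed.

End SPolyLead.

(** * Differential ideals as ordinary ideals generated by derivatives *)

Section DifferentialIdeal.
Context (k : fieldType) (d : Order.disp_t) (X : orderType d).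
Implicit Types (f g h p q s : dpoly k X) (u v w : word X) (S : set (dpoly k X)).

(** Passing from [S] to its derivatives reduces the differential theory to the commutative one: by
    [trivialE], triviality with respect to [S] is [span_below] for this set. Zero derivatives are
    excluded because they have no meaningful leading word. *)
Definition derivatives S : set (dpoly k X) :=
  [set p | exists t s, [/\ S s, dopn t s <> 0 & p = dopn t s]].

Local Notation L := (dpoly_leading k X).

Lemma derivatives_neq0 S p : derivatives S p -> p <> 0.
Proof. by move=> [t [s [_ + ->]]]. Qed.

Lemma derivativesS S T : S `<=` T -> derivatives S `<=` derivatives T.
Proof. by move=> ST _ [t [s [Ss t0 ->]]]; exists t, s; split=> //; apply: ST. Qed.

Lemma multiplesS S T P : S `<=` T ->
  multiples L (derivatives S) P `<=` multiples L (derivatives T) P.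
Proof.
by move=> ST _ [u [g [Sg -> Pg]]]; exists u, g; split=> //; apply: derivativesS Sg.
Qed.

Lemma trivialE S w : trivial S w = span_below L (derivatives S) w.
Proof.
congr lin_span; apply/predeqP => p; split.
  by move=> [u [t [s [Ss t0 -> lt]]]]; exists u, (dopn t s); split=> //; exists t, s.
by move=> [u [_ [[t [s [Ss t0 ->]]] -> lt]]]; exists u, t, s.
Qed.

Lemma diff_ideal_dopn S t s : diff_ideal S s -> diff_ideal S (dopn t s).
Proof.
have [_ _ _ ID] := diff_ideal_idealP S.
by move=> Ss; elim: t => //= t; apply: ID.
Qed.

Lemma diff_ideal_gen S : S `<=` diff_ideal S.
Proof. by move=> s Ss I [_]; apply. Qed.

Lemma diff_idealZ S c f : diff_ideal S f -> diff_ideal S (c *: f).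
Proof.
have [I0 IL _ _] := diff_ideal_idealP S.
by move=> If; rewrite -[_ *: _]addr0; apply: IL.
Qed.

(** The span of the multiples is stable under [dop], since D (u D^t s) = D u * D^t s + u * D^(t+1)
    s; the last term is again a multiple or zero. *)
Lemma diff_ideal_span S :
  diff_ideal S `<=` lin_span (multiples L (derivatives S) setT).
Proof.
move=> f; apply; split; last first.
  move=> s Ss; have [->|/eqP s0] := eqVneq s 0; first exact: lin_span0.
  apply: lin_span_gen; exists 1%M, s; split=> //; first by exists 0%N, s.
  by rewrite [RHS]mul1r.
have spM g h : lin_span (multiples L (derivatives S) setT) h ->
    lin_span (multiples L (derivatives S) setT) (g * h).
  by apply: multiples_mul; apply/lin_span_mon.
split=> //.
- exact: lin_span0.
- by move=> c g h; apply: lin_spanP.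
- apply: lin_span_image => _ [u [_ [[t [s [Ss t0 ->]]] -> _]]].
  rewrite -[X in lin_span _ X]/(dop (<< u >> * dopn t s)) dopM; apply: lin_spanD.
    apply: spM; apply: lin_span_gen; exists 1%M, (dopn t s).
    by split=> //; [exists t, s|rewrite [RHS]mul1r].
  have [t1|/eqP t1] := eqVneq (dop (dopn t s)) 0.
    by rewrite t1 mulr0; apply: lin_span0.
  apply: lin_span_gen; exists u, (dopn t.+1 s); split=> //.
  by exists t.+1, s.
Qed.

End DifferentialIdeal.

(** * The Buchberger-Shirshov completion *)

Section Completion.
Context (k : fieldType) (d : Order.disp_t) (X : orderType d).
Implicit Types (f g h p q s : dpoly k X) (u v w : word X).
Context (S : set (dpoly k X)).
Local Notation L := (dpoly_leading k X).
Local Notation Sc := (buchberger_shirshov S).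

Lemma stageS m n : (m <= n)%N -> buchberger_stage S m `<=` buchberger_stage S n.
Proof.
elim: n => [|n IH]; first by rewrite leqn0 => /eqP->.
by rewrite leq_eqVlt => /predU1P[-> //|/IH h] s /h; left.
Qed.

Lemma stage_sub n : buchberger_stage S n `<=` Sc.
Proof. by move=> s sn; exists n. Qed.

Lemma sub_completion : S `<=` Sc.
Proof. exact: (@stage_sub 0). Qed.

(** Properties inherited by compositions, such as homogeneity or membership in Id[S], pass to the
    completion by this induction on the stages. *)
Lemma completion_ind (P : dpoly k X -> Prop) : S `<=` P ->
  (forall w h (T : set (dpoly k X)), T `<=` P ->
     composition (@nontrivial_lcm d X) T w h -> P h) ->
  Sc `<=` P.
Proof.
move=> SP CP s [n _]; elim: n s => [|n IH] s; first exact: SP.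
by move=> [/IH //|[w hw _]]; apply: CP hw.
Qed.

Lemma completion_diff_ideal : Sc `<=` diff_ideal S.
Proof.
apply: completion_ind; first exact: diff_ideal_gen.
move=> w h T TI [f g t1 t2 u1 u2 /TI If /TI Ig _ _ _ _ _].
have [_ IL IM _] := diff_ideal_idealP S.
rewrite /composition_of -scaleN1r addrC; apply: IL.
  by apply: diff_idealZ; apply: IM; apply: diff_ideal_dopn.
by apply: diff_idealZ; apply: IM; apply: diff_ideal_dopn.
Qed.

Lemma homog_dopn n t f : f \in homog n -> dopn t f \in homog (n + t%:Z).
Proof.
move=> fn; elim: t => [|t IH]; first by rewrite addr0.
by rewrite intS [1 + _]addrC addrA; apply: (homog_dop IH).
Qed.

Lemma homog_lead n f : f <> 0 -> f \in homog n -> wt (lead f) = n.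
Proof. by move=> f0 /homogP; apply; apply: lead_in. Qed.

Lemma homog_monM n u f : f \in homog n -> << u >> * f \in homog (wt u + n).
Proof. by move=> fn; apply: homogM => //; apply: homogU. Qed.

Lemma homog_composition_of n p q u v :
  << u >> * p \in homog n -> << v >> * q \in homog n ->
  composition_of p q u v \in homog n.
Proof.
move=> hp hq; rewrite /composition_of -scaleN1r.
exact: (homogD (homogZ _ hp) (homogZ _ (homogZ _ hq))).
Qed.

Lemma composition_homog (ovl : word X -> word X -> word X -> Prop)
    (T : set (dpoly k X)) w h :
  (forall s, T s -> exists n, s \in homog n) ->
  composition ovl T w h -> h \in homog (wt w).
Proof.
move=> TH [f g t1 t2 u1 u2 /TH[n1 fn] /TH[n2 gn] f0 g0 w1 w2 _].
apply: homog_composition_of.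
  rewrite w1 wtM (homog_lead f0 (homog_dopn t1 fn)).
  exact/homog_monM/homog_dopn.
rewrite w2 wtM (homog_lead g0 (homog_dopn t2 gn)).
exact/homog_monM/homog_dopn.
Qed.

Lemma completion_homog : (forall s, S s -> exists n, s \in homog n) ->
  forall s, Sc s -> exists n, s \in homog n.
Proof.
move=> SH; apply: completion_ind => // w h T TH hw.
by exists (wt w); apply: composition_homog hw.
Qed.

(** Two elements of the completion lie in a common stage. Their composition is trivial there, or is
    added at the next stage and is then a multiple of itself, with leading word below [w] by
    cancellation. *)
Lemma completion_gs : s_trivial L (derivatives Sc).
Proof.
move=> _ _ u v w [t1 [f [[n _ fn] f0 ->]]] [t2 [g [[m _ gm] g0 ->]]] wlcm wu wv.
have comp : composition (@nontrivial_lcm d X) (buchberger_stage S (maxn n m)) w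
    (composition_of (dopn t1 f) (dopn t2 g) u v).
  by apply: Composition => //; [apply: stageS fn; rewrite leq_maxl
    | apply: stageS gm; rewrite leq_maxr].
rewrite -[s_poly _ _ _ _ _]/(composition_of (dopn t1 f) (dopn t2 g) u v).
move: comp; set h := composition_of _ _ _ _ => comp.
have [|hN] := pselect (trivial (buchberger_stage S (maxn n m)) w h).
  by rewrite trivialE; apply: lin_spanS; apply: multiplesS; apply: stage_sub.
(* The zero polynomial is trivial as an empty sum, so a composition that is not trivial has a
   genuine leading word. *)
have h0 : h <> 0 by move=> h0; apply: hN; rewrite h0; apply: lin_span0.
apply: lin_span_gen; exists 1%M, h; split.
- exists 0%N, h; split=> //; apply: (@stage_sub (maxn n m).+1).
  by right; exists w.
- by rewrite [RHS]mul1r.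
- by apply/(lead_lt w h0)/(@s_poly_below _ _ _ _ L).
Qed.

Theorem diff_ideal_lead : well_founded (fun a b : X => (a < b)%O) ->
  forall f, diff_ideal S f -> f <> 0 ->
  exists u t s, [/\ Sc s, dopn t s <> 0 & lead f = (u * lead (dopn t s))%M].
Proof.
move=> wfX f /diff_ideal_span fS f0.
have fSc : lin_span (multiples L (derivatives Sc) setT) f.
  by apply: lin_spanS fS; apply/multiplesS/sub_completion.
have [u [_ [[t [s [Ss s0 ->]]] fE]]] :=
    lead_reducible (@derivatives_neq0 _ _ _ Sc) (wf_word wfX) completion_gs fSc f0.
by exists u, t, s.
Qed.

End Completion.

(** * Ideals for the product (D x) y inside an algebra with derivation *)

Section DerivationIdeal.
Context (k : fieldType) (A : comAlgType k) (D : {linear A -> A}).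
Context (DM : forall x y, D (x * y) = D x * y + x * D y).
Context (H I : set A).
Context (I0 : I 0) (IL : forall (c : k) x y, I x -> I y -> I (c *: x + y)).
Context (IDl : forall x b, I x -> H b -> I (D x * b)).
Context (IDr : forall b x, H b -> I x -> I (D b * x)).
Implicit Types (x y b : A) (bs : seq A).

Let ID x y : I x -> I y -> I (x + y).
Proof. by rewrite -[x in x + y]scale1r; apply: IL. Qed.

Let IB x y : I x -> I y -> I (x - y).
Proof. by move=> Ix Iy; rewrite addrC -scaleN1r; apply: IL. Qed.

Let D1 : D 1 = 0.
Proof.
have := DM 1 1; rewrite !mulr1 mul1r => /eqP.
by rewrite -subr_eq0 opprD addrA subrr sub0r oppr_eq0 => /eqP.
Qed.

Let all_in bs := forall b, b \in bs -> H b.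

Let all_inE b bs : all_in (b :: bs) -> H b /\ all_in bs.
Proof.
by move=> h; split=> [|c cbs]; apply: h; rewrite in_cons ?eqxx ?cbs ?orbT.
Qed.

Let all_in_cons b bs : H b -> all_in bs -> all_in (b :: bs).
Proof. by move=> Hb Hbs c; rewrite in_cons => /predU1P[->|/Hbs]. Qed.

(** By the Leibniz rule the element is the sum of the products of D b_i with the remaining factors
    times [x]; each remaining product is in [I] by hypothesis, and [IDr] puts D b_i in front. *)
Lemma ideal_deriv_prod bs x : all_in bs ->
  (forall bs', (size bs').+1 = size bs -> all_in bs' -> I ((\prod_(b <- bs') b) * x)) ->
  I (D (\prod_(b <- bs) b) * x).
Proof.
elim: bs x => [|b bs IH] x; first by rewrite big_nil D1 mul0r.
move=> /all_inE[Hb Hbs] h; rewrite big_cons DM mulrDl; apply: ID.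
  by rewrite -mulrA; apply: IDr => //; apply: h.
rewrite -mulrA mulrCA; apply: IH => // bs' sz Hbs'.
rewrite mulrCA mulrA -[b * _](big_cons _ _ _ _ xpredT id).
by apply: h; [rewrite /= sz|apply: all_in_cons].
Qed.

Lemma ideal_iter_deriv t x : I x -> forall bs, size bs = t -> all_in bs ->
  I ((\prod_(b <- bs) b) * iter t D x).
Proof.
move=> Ix; elim: t => [|t IH] bs; first by move/size0nil->; rewrite big_nil mul1r.
case: bs => // b bs [sz] /all_inE[Hb Hbs] /=; rewrite big_cons.
have -> : b * (\prod_(c <- bs) c) * D (iter t D x) =
    D ((\prod_(c <- bs) c) * iter t D x) * b -
    D (\prod_(c <- bs) c) * (b * iter t D x).
  rewrite DM mulrDl [b * iter _ _ _]mulrC mulrA addrAC subrr add0r.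
  by rewrite -mulrA mulrC.
apply: IB; first by apply: IDl => //; apply: IH.
(* Dropping one factor of [bs] and taking [b] back leaves exactly t factors in front of D^t x, as
   the induction hypothesis requires. *)
apply: ideal_deriv_prod => // bs' sz' Hbs'.
rewrite mulrCA mulrA -[b * _](big_cons _ _ _ _ xpredT id).
by apply: IH; [rewrite /= sz'|apply: all_in_cons].
Qed.

(** This is multiplication by a group b_1 ... b_n a[n] of weight 0. With P = b_1 ... b_n, one has P
    D^(n+1) a x = D (P D^n a) x - D P (D^n a x). The first term is a product of P D^n a in [H] with
    [x]; the second reduces by Leibniz to products with n - 1 factors, where the order of the
    derivative of [a] has dropped as well. *)
Lemma ideal_mul_iter_deriv (a x : A) : H a -> I x ->
  (forall bs, all_in bs -> H ((\prod_(b <- bs) b) * iter (size bs) D a)) ->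
  forall bs, all_in bs -> I ((\prod_(b <- bs) b) * (iter (size bs).+1 D a * x)).
Proof.
move=> Ha Ix HM bs; move: {2}(size bs) (erefl (size bs)) => t.
elim: t bs => [|t IH] bs sz Hbs.
  by rewrite (size0nil sz) big_nil mul1r; apply: IDr.
have -> : (\prod_(b <- bs) b) * (iter (size bs).+1 D a * x) =
    D ((\prod_(b <- bs) b) * iter (size bs) D a) * x -
    D (\prod_(b <- bs) b) * (iter (size bs) D a * x).
  by rewrite DM mulrDl !mulrA addrAC subrr add0r.
apply: IB; first by apply: IDr => //; apply: HM.
apply: ideal_deriv_prod => // bs' sz' Hbs'.
rewrite -sz'; apply: IH => //.
by move: sz'; rewrite sz => -[].
Qed.

End DerivationIdeal.

(** * Projection onto a weight component *)

Section WeightComponent.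
Context (k : fieldType) (d : Order.disp_t) (X : orderType d).
Implicit Types (f g : dpoly k X) (u v w : word X) (c : k) (n : int).

Definition weight_component n f : dpoly k X :=
  [malg w in msupp f => if wt w == n then f@_w else 0].

Lemma mcoeff_weight_component n f w :
  (weight_component n f)@_w = if wt w == n then f@_w else 0.
Proof.
rewrite /weight_component mcoeffE; case: msuppP => // _.
by case: ifP.
Qed.

Lemma weight_componentP n c f g : weight_component n (c *: f + g) =
  c *: weight_component n f + weight_component n g.
Proof.
apply/malgP => w; rewrite mcoeffD mcoeffZ !mcoeff_weight_component.
by rewrite mcoeffD mcoeffZ; case: ifP => // _; rewrite mulr0 addr0.
Qed.

Lemma weight_component_homog n f : f \in homog n -> weight_component n f = f.
Proof.
move=> /homogP fn; apply/malgP => w; rewrite mcoeff_weight_component.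
by case: msuppP => [/fn -> | _]; rewrite ?eqxx //; case: ifP.
Qed.

Lemma weight_component_neq n m f : n != m -> f \in homog m ->
  weight_component n f = 0.
Proof.
move=> nm /homogP fm; apply/malgP => w; rewrite mcoeff_weight_component mcoeff0.
by case: msuppP => [/fm -> | _]; rewrite ?[m == n]eq_sym ?(negbTE nm) //; case: ifP.
Qed.

End WeightComponent.

(** * Factorization of words into letters *)

Section GDNIdeal.
Context (k : fieldType) (d : Order.disp_t) (X : orderType d).
Implicit Types (f g : dpoly k X) (u v w : word X) (l : letter X).

Lemma word_prod_letters w : w = \big[mmul/1%M]_(l <- letters w) ucm l.
Proof.
apply/eqP/cmP => l.
have -> : (\big[mmul/1%M]_(j <- letters w) ucm j) l = count_mem l (letters w).
  rewrite (big_morph (fun v : word X => v l) (id1 := 0%N) (op1 := addn)).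
  - rewrite -sum1_count [RHS]big_mkcond; apply: eq_bigr => j _ /=.
    by rewrite cmU; case: (j == l).
  - by move=> u v; rewrite cmM.
  - by rewrite cm1.
by rewrite count_letters.
Qed.

Lemma mon_prod_letters w :
  << w >> = \prod_(l <- letters w) << ucm l >> :> dpoly k X.
Proof.
rewrite [in LHS](word_prod_letters w).
by apply: (big_morph (fun v : word X => << v >> : dpoly k X)) => // u v; apply: malgUM.
Qed.

Lemma wt_sum_letters w : wt w = \sum_(l <- letters w) (l.1%:Z - 1).
Proof.
rewrite {1}(word_prod_letters w).
rewrite (big_morph (@wt d X) (id1 := 0) (op1 := +%R)).
- by apply: eq_bigr => l _; apply: wt_letter.
- exact: wtM.
- by rewrite /wt mdom1 big_seq_fset0.
Qed.

Lemma mon_letter l : << ucm l >> = dopn l.1 << ucm (0%N, l.2) >> :> dpoly k X.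
Proof.
case: l => n a /=; elim: n => //= n <-.
by rewrite dop_letter.
Qed.

End GDNIdeal.

(** * The differential ideal meets GDN(X) in the ideal Id(S) *)

Section GDNIdealTrace.
Context (k : fieldType) (d : Order.disp_t) (X : orderType d).
Implicit Types (f g x : dpoly k X) (u v w : word X) (l : letter X).
Context (S : set (gdn k X)).
Local Notation I := [set \val f | f in gdn_ideal S].
Local Notation H := [set f | f \in @gdn_pred k d X].
Local Notation S0 := [set \val f | f in S].

Lemma val_gdn_ideal0 : I 0.
Proof. by have [I0 _ _ _] := gdn_ideal_idealP S; exists 0. Qed.

Lemma val_gdn_idealP (c : k) f g : I f -> I g -> I (c *: f + g).
Proof.
have [_ IL _ _] := gdn_ideal_idealP S.
by move=> [f' If <-] [g' Ig <-]; exists (c *: f' + g') => //; apply: IL.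
Qed.

Lemma val_gdn_ideal_mull f b : I f -> H b -> I (dop f * b).
Proof.
have [_ _ IM _] := gdn_ideal_idealP S.
by move=> [f' If <-] Hb; exists (gdn_mul f' (Gdn Hb)) => //; apply: IM.
Qed.

Lemma val_gdn_ideal_mulr b f : H b -> I f -> I (dop b * f).
Proof.
have [_ _ _ IM] := gdn_ideal_idealP S.
by move=> Hb [f' If <-]; exists (gdn_mul (Gdn Hb) f') => //; apply: IM.
Qed.

Lemma homog_prod (bs : seq (dpoly k X)) : (forall b, b \in bs -> H b) ->
  \prod_(b <- bs) b \in homog (- (size bs)%:Z).
Proof.
elim: bs => [|b bs IH] h.
  by rewrite big_nil; apply: homogU; rewrite /wt mdom1 big_seq_fset0.
rewrite big_cons /= intS opprD; apply: homogM.
  by apply: h; rewrite in_cons eqxx.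
by apply: IH => c cbs; apply: h; rewrite in_cons cbs orbT.
Qed.

Lemma homog_prod_dopn (a : dpoly k X) (bs : seq (dpoly k X)) : H a ->
  (forall b, b \in bs -> H b) -> H ((\prod_(b <- bs) b) * dopn (size bs) a).
Proof.
move=> Ha Hbs; have := homogM (homog_prod Hbs) (homog_dopn (size bs) Ha).
by rewrite addrCA addNr addr0.
Qed.

(** [dop] with its linear structure made explicit, to instantiate the abstract derivation of the
    preceding lemmas. *)
Definition dop_linear : {linear dpoly k X -> dpoly k X} := @dop k d X.

(** A letter a[i] of [ds] has [l.1 = i + 1] and thus weight [l.1.-1]. The size condition lets each
    such letter claim i factors of [cs] to form a group of weight 0, and leaves t factors to
    accompany D^t s. *)
Lemma prod_letters_ideal (t : nat) (s : dpoly k X) : I s ->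
  forall (ds : seq (letter X)) (cs : seq (dpoly k X)),
  all (fun l => 0 < l.1)%N ds -> (forall c, c \in cs -> H c) ->
  size cs = (t + \sum_(l <- ds) l.1.-1)%N ->
  I ((\prod_(c <- cs) c) * ((\prod_(l <- ds) << ucm l >>) * dopn t s)).
Proof.
move=> Is; elim=> [|[[|n] a] ds IH] cs //=.
  rewrite !big_nil mul1r addn0 => _ Hcs sz.
  exact: (@ideal_iter_deriv k _ dop_linear (@dopM k d X) H I val_gdn_ideal0
    val_gdn_idealP val_gdn_ideal_mull val_gdn_ideal_mulr t s Is cs sz Hcs).
move=> ds0 Hcs; rewrite !big_cons /= => sz.
(* The letter encoded by [(n.+1, a)] is a[n]: it claims the first n factors, and the others go to
   the induction hypothesis. *)
have Htake c : c \in take n cs -> H c by move=> /mem_take; apply: Hcs.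
have Hdrop c : c \in drop n cs -> H c by move=> /mem_drop; apply: Hcs.
have szt : size (take n cs) = n by rewrite size_takel // sz; lia.
have szd : size (drop n cs) = (t + \sum_(l <- ds) l.1.-1)%N.
  by rewrite size_drop sz addnCA addKn.
have Ix := IH _ ds0 Hdrop szd.
have Ha : H (<< ucm (0%N, a) >> : dpoly k X) by apply: homogU; rewrite wt_letter.
have := @ideal_mul_iter_deriv k _ dop_linear (@dopM k d X) H I val_gdn_ideal0
  val_gdn_idealP val_gdn_ideal_mulr << ucm (0%N, a) >> _ Ha Ix
  (fun bs => @homog_prod_dopn _ bs Ha) (take n cs) Htake.
rewrite szt -[iter _ _ _](mon_letter k (n.+1, a)).
have -> : \prod_(c <- cs) c = (\prod_(c <- take n cs) c) * \prod_(c <- drop n cs) c.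
  by rewrite -big_cat cat_take_drop.
by move=> h; rewrite -!mulrA [\prod_(c <- drop n cs) c * _]mulrCA; exact: h.
Qed.

Lemma wt_letters_partition (ls : seq (letter X)) :
  \sum_(l <- ls) (l.1%:Z - 1) =
  (\sum_(l <- [seq l <- ls | (0 < l.1)%N]) l.1.-1)%N%:Z
  - (size [seq l <- ls | ~~ (0 < l.1)%N])%:Z.
Proof.
elim: ls => [|[[|n] a] ls IH] /=; rewrite ?big_nil ?big_cons //= IH.
  by rewrite intS opprD addrCA.
by rewrite PoszD intS [1 + _]addrC addrK addrA.
Qed.

(** Only letters a[-1] have negative weight, so [wt u = - t] says that their number is t plus the
    total weight of the other letters. This is the count that [prod_letters_ideal] needs. *)
Lemma mon_dopn_ideal (t : nat) u (s : dpoly k X) : I s -> wt u = - t%:Z ->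
  I (<< u >> * dopn t s).
Proof.
move=> Is; rewrite wt_sum_letters wt_letters_partition mon_prod_letters => wtu.
pose z l := ~~ (0 < l.1)%N.
have perm : perm_eq (letters u)
    ([seq l <- letters u | z l] ++ [seq l <- letters u | (0 < l.1)%N]).
  by rewrite perm_sym perm_catC perm_filterC.
rewrite (perm_big _ perm) big_cat /= -mulrA.
rewrite -[\prod_(l <- [seq l <- _ | z l]) _](big_map (fun l => << ucm l >>) xpredT id).
apply: prod_letters_ideal => //.
- exact: filter_all.
- move=> _ /mapP[l + ->]; rewrite mem_filter /z -eqn0Ngt => /andP[/eqP l0 _].
  by apply: homogU; rewrite wt_letter l0.
- rewrite size_map; move: wtu; rewrite /z.
  by move: (size _) (\sum_(l <- _) l.1.-1)%N => p q; lia.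
Qed.

Lemma gdn_ideal_homog f : I f -> f \in homog (-1).
Proof. by move=> [g _ <-]; apply: valP. Qed.

Lemma gdn_ideal_gen : S0 `<=` I.
Proof. by move=> _ [s Ss <-]; exists s => // J [_]; apply. Qed.

Lemma gdn_ideal_sub_diff_ideal : I `<=` diff_ideal S0.
Proof.
move=> _ [f If <-].
apply: (If [set g : gdn k X | diff_ideal S0 (\val g)]); split; last first.
  by move=> s Ss; apply: diff_ideal_gen; exists s.
have [I0 IL IM ID] := diff_ideal_idealP S0.
split=> //.
- by move=> c g h; apply: IL.
- by move=> g h Ig; rewrite /= mulrC; apply: IM; apply: ID.
- by move=> g h Ih; apply: IM.
Qed.

(* A multiple u D^t s is homogeneous, so its weight -1 component is itself or
   zero. *)
Lemma diff_ideal_weight f : diff_ideal S0 f -> I (weight_component (-1) f).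
Proof.
move=> /diff_ideal_span; move: f; apply: lin_span_rec.
  rewrite weight_component_homog; last exact: homog0.
  exact: val_gdn_ideal0.
move=> c x y [u [_ [[t [s [Ss s0 ->]]] -> _]]] _ IH.
rewrite weight_componentP; apply: val_gdn_idealP => //.
have Is := gdn_ideal_gen Ss.
have xh := homog_monM u (homog_dopn t (gdn_ideal_homog Is)).
have [wtx|wtx] := eqVneq (wt u + (-1 + t%:Z)) (-1).
  rewrite weight_component_homog; last by rewrite -[X in homog X]wtx.
  apply: mon_dopn_ideal => //; lia.
rewrite (@weight_component_neq _ _ _ (-1) (wt u + (-1 + t%:Z))) //.
  exact: val_gdn_ideal0.
by rewrite eq_sym.
Qed.

(** For the converse, an element of GDN(X) is its own component of weight -1, so [diff_ideal_weight]
    applies to it. *)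
Theorem gdn_idealE (f : gdn k X) : gdn_ideal S f <-> diff_ideal S0 (\val f).
Proof.
split=> [If|/diff_ideal_weight]; first by apply: gdn_ideal_sub_diff_ideal; exists f.
rewrite weight_component_homog; last exact: valP.
by move=> [g Ig /val_inj <-].
Qed.

End GDNIdealTrace.

(** * Division in weight -1 and the Gröbner-Shirshov property of S' *)

Lemma normalized_diffK (k : fieldType) (V : lmodType k) (a b : k) (x y : V) :
  a != 0 -> x = (a / b) *: y + a *: (a^-1 *: x - b^-1 *: y).
Proof. by move=> a0; rewrite scalerBr !scalerA mulfV // scale1r addrC subrK. Qed.

Section Reduction.
Context (k : fieldType) (d : Order.disp_t) (X : orderType d).
Context (wfX : well_founded (fun a b : X => (a < b)%O)) (S : set (gdn k X)).
Implicit Types (f g h p q s x : dpoly k X) (u v w : word X).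
Local Notation L := (dpoly_leading k X).
Local Notation S0 := [set \val f | f in S].
Local Notation Sc := (buchberger_shirshov S0).

Definition weighted_multiples : set (dpoly k X) :=
  [set x | exists s u m, [/\ Sc s, dopn m s <> 0,
     wt (u * lead (dopn m s))%M = -1 & x = << u >> * dopn m s]].
Local Notation S' := weighted_multiples.

Lemma gdn_completion_homog s : Sc s -> exists n, s \in homog n.
Proof.
apply: completion_homog => _ [f _ <-]; exists (-1); exact: valP.
Qed.

Lemma homog_multiple u t s : Sc s -> dopn t s <> 0 ->
  << u >> * dopn t s \in homog (wt (u * lead (dopn t s))%M).
Proof.
move=> /gdn_completion_homog[n sn] s0; rewrite wtM.
have tn := homog_dopn t sn; rewrite (homog_lead s0 tn).
exact: homog_monM.
Qed.

Lemma weighted_multiples_homog x : S' x -> x \in homog (-1).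
Proof.
by move=> [s [u [m [Ss s0 wt1 ->]]]]; rewrite -[X in homog X]wt1; apply: homog_multiple.
Qed.

Lemma multiple_diff_ideal u t s : Sc s -> diff_ideal S0 (<< u >> * dopn t s).
Proof.
have [_ _ IM _] := diff_ideal_idealP S0.
by move=> Ss; apply: IM; apply: diff_ideal_dopn; apply: completion_diff_ideal.
Qed.

Lemma weighted_multiples_diff_ideal x : S' x -> diff_ideal S0 x.
Proof. by move=> [s [u [m [Ss _ _ ->]]]]; apply: multiple_diff_ideal. Qed.

Lemma mon1_mul f : << 1%M >> * f = f.
Proof. exact: mul1r. Qed.

(* One step of division of f by a multiple of g with the same leading word;
   the remainder is an S-polynomial. *)
Lemma division_step f g u n : f <> 0 -> g <> 0 ->
  lead f = (u * lead g)%M -> f \in homog n -> << u >> * g \in homog n ->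
  exists (c a : k) r, [/\ f = c *: (<< u >> * g) + a *: r, r \in homog n,
    r <> 0 -> (lead r < lead f)%O &
    forall T, diff_ideal T f -> diff_ideal T g -> diff_ideal T r].
Proof.
move=> f0 g0 fg fn gn; pose r := (lc f)^-1 *: f - (lc g)^-1 *: (<< u >> * g).
have rE : s_poly L f g 1%M u = r.
  exact: (congr1 (fun z => (lc f)^-1 *: z - _) (mon1_mul f)).
have f1 : lead f = (1%M * lead f)%M by rewrite mul1m.
exists (lc f / lc g), (lc f), r; split.
- exact: (normalized_diffK (lc g) f (<< u >> * g) (lc_neq0 f0)).
- rewrite /r -scaleN1r.
  exact: (homogD (homogZ _ fn) (homogZ _ (homogZ _ gn))).
- move=> r0; apply/(lead_lt _ r0); rewrite -rE.
  exact: (@s_poly_below _ _ _ _ L f g 1%M u _ f0 g0 f1 fg).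
- move=> T Tf Tg; have [_ IL IM _] := diff_ideal_idealP T.
  rewrite /r -scaleN1r addrC.
  exact: (IL _ _ _ (diff_idealZ _ (IM _ _ Tg)) (diff_idealZ _ Tf)).
Qed.

(** Induction on the leading word: [diff_ideal_lead] supplies a multiple to divide by, homogeneity
    of the completion keeps multiple and remainder in weight -1, and the remainder stays in Id[S]
    with a smaller leading word. *)
Lemma diff_ideal_gdn_trivial w h : diff_ideal S0 h -> h \in homog (-1) ->
  (h <> 0 -> (lead h < w)%O) -> gdn_trivial S' w h.
Proof.
move: {2}(lead h) (erefl (lead h)) => v vE.
elim/(well_founded_ind (wf_word wfX)): v h vE => v IH h vE Ih h1 hw.
have [->|/eqP h0] := eqVneq h 0; first exact: lin_span0.
have [u [t [s [Ss s0 hE]]]] := diff_ideal_lead wfX Ih h0.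
have xn := homog_multiple u Ss s0; rewrite -hE (homog_lead h0 h1) in xn.
have [c [a [r [hr rn rw rI]]]] := division_step h0 s0 hE h1 xn.
have Ig : diff_ideal S0 (dopn t s).
  by apply: diff_ideal_dopn; apply: completion_diff_ideal.
rewrite hr; apply: lin_spanD; apply: lin_spanZ; last first.
  have [->|/eqP r0] := eqVneq r 0; first exact: lin_span0.
  have lr := rw r0.
  rewrite -vE in IH; apply: (IH _ lr r erefl (rI _ Ih Ig) rn) => _.
  exact: lt_trans lr (hw h0).
have x0 : << u >> * dopn t s <> 0 by apply: mon_mul_neq0.
have xE : lead (<< u >> * dopn t s) = lead h by rewrite lead_monM.
(* The multiple u D^t s is itself an element of S', so it enters with cofactor 1 and no further
   derivative. *)
apply: lin_span_gen; exists 1%M, 0%N, (<< u >> * dopn t s); split.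
- by exists s, u, t; split=> //; rewrite -hE (homog_lead h0 h1).
- exact: x0.
- exact: (esym (mon1_mul _)).
- by rewrite xE (homog_lead h0 h1).
- by rewrite xE; apply: hw.
Qed.

(** The kind of overlap does not matter: every composition lies in Id[S], is homogeneous of weight
    -1 and has leading word below [w], so division makes it trivial. *)
Lemma weighted_multiples_gs : gdn_gs_basis S'.
Proof.
split=> [x /weighted_multiples_homog //|w h hw].
have h1 : h \in homog (wt w).
  by apply: composition_homog hw => s /weighted_multiples_homog; exists (-1).
case: hw h1 => f g t1 t2 u1 u2 Sf Sg f0 g0 w1 w2 [wt1 _]; rewrite wt1 => h1.
apply: diff_ideal_gdn_trivial => //.
  have [_ IL IM _] := diff_ideal_idealP S0.
  rewrite /composition_of -scaleN1r addrC; apply: IL; apply: diff_idealZ; apply: IM;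
    apply: diff_ideal_dopn; exact: weighted_multiples_diff_ideal.
move=> h0; apply/(lead_lt _ h0).
exact: (@s_poly_below _ _ _ _ L (dopn t1 f) (dopn t2 g) u1 u2).
Qed.

(** A word of weight -1 divisible by some lead (D^t s), s in S^c, is the leading word of an element
    of S'. Conversely, derivatives of elements of S' lie in Id[S], so [diff_ideal_lead] makes their
    leading words multiples of such words. *)
Lemma gdn_irr_weighted_multiples : gdn_irr S' =
  [set w | wt w = -1 /\ forall u t s,
     Sc s -> dopn t s <> 0 -> w <> (u * lead (dopn t s))%M].
Proof.
apply/predeqP => w; split=> -[wt1 wN]; split=> // u t s Ss s0 wE.
  have x0 : << u >> * dopn t s <> 0 by apply: mon_mul_neq0.
  apply: (wN 1%M 0%N (<< u >> * dopn t s)) => //.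
    by exists s, u, t; split=> //; rewrite -wE.
  by rewrite mul1m [lead _]lead_monM.
have Is : diff_ideal S0 (dopn t s).
  by apply: diff_ideal_dopn; apply: weighted_multiples_diff_ideal.
have [v [m [s' [Ss' s0' sE]]]] := diff_ideal_lead wfX Is s0.
by apply: (wN (u * v)%M m s') => //; rewrite wE sE mulmA.
Qed.

Lemma homog_mon n w : (<< w >> : dpoly k X) \in homog n <-> wt w = n.
Proof.
by split=> [/homogP|]; [apply; rewrite msuppU1 in_fset1 | exact: homogU].
Qed.

Lemma gdn_irrE : gdn_irr S' =
  [set w | (<< w >> : dpoly k X) \in gdn_pred] `&` irr Sc.
Proof.
rewrite gdn_irr_weighted_multiples; apply/predeqP => w.
by split=> -[w1 wN]; split=> //; apply/homog_mon.
Qed.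

End Reduction.

(** * The linear basis of GDN(X|S) and the embedding *)

Lemma mcoeff_sum_mon (k : fieldType) (d : Order.disp_t) (X : orderType d)
    (r : seq (word X)) (c : word X -> k) w : uniq r ->
  (\sum_(i <- r) c i *: << i >> : dpoly k X)@_w = if w \in r then c w else 0.
Proof.
move=> ur; rewrite raddf_sum /=.
transitivity (\sum_(i <- r) if i == w then c i else 0).
  by apply: eq_bigr => i _; rewrite -malgUZ mcoeffU; case: eqP.
case: ifPn => wr; last first.
  by rewrite big_seq big1 // => i ir; case: eqP => // iw; rewrite -iw ir in wr.
by rewrite (bigD1_seq w) //= eqxx big1 ?addr0 // => i /negbTE->.
Qed.

Section Basis.
Context (k : fieldType) (d : Order.disp_t) (X : orderType d).
Context (wfX : well_founded (fun a b : X => (a < b)%O)) (S : set (gdn k X)).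
Implicit Types (f s : dpoly k X) (u v w : word X).
Local Notation S0 := [set \val f | f in S].
Local Notation Sc := (buchberger_shirshov S0).
Local Notation B := (gdn_irr (weighted_multiples S)).

Lemma val_gdn_word w : wt w = -1 -> \val (gdn_word k w) = << w >>.
Proof. by move=> w1; rewrite /gdn_word val_insubd ifT //; apply/homog_mon. Qed.

Lemma val_gdn_sum (r : seq (word X)) (c : word X -> k) :
  (forall w, w \in r -> wt w = -1) ->
  \val (\sum_(w <- r) c w *: gdn_word k w) = \sum_(w <- r) c w *: << w >>.
Proof.
elim: r => [|w r IH] rw; first by rewrite !big_nil.
rewrite !big_cons -IH => [|v vr]; last by apply: rw; rewrite in_cons vr orbT.
rewrite -(val_gdn_word (rw w _)); last by rewrite in_cons eqxx.
reflexivity.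
Qed.

(** Induction on the leading word, removed at each step by an irreducible word or by an element of
    the ideal. *)
Lemma gdn_spanning (f : gdn k X) :
  lin_span ([set gdn_word k w | w in B] `|` gdn_ideal S) f.
Proof.
move: {2}(lead (\val f)) (erefl (lead (\val f))) => v vE.
elim/(well_founded_ind (wf_word wfX)): v f vE => v IH f vE.
have [f0|/eqP f0] := eqVneq (\val f) 0.
  by have -> : f = 0 by [apply/val_inj]; apply: lin_span0.
have f1 : \val f \in homog (-1) := valP f.
(* Both cases are division steps by a multiple of some [g]: an irreducible leading word takes
   [g = 1] with itself as cofactor, a reducible one takes a derivative from the completion. *)
suff [g [u [g0 fE ug1 ugG]]] : exists g u, [/\ g <> 0, lead (\val f) = (u * lead g)%M,
    (<< u >> * g) \in homog (-1) & forall z : gdn k X, \val z = << u >> * g ->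
    ([set gdn_word k w | w in B] `|` gdn_ideal S) z].
  have [c [a [r [fr rn rw _]]]] := division_step f0 g0 fE f1 ug1.
  have -> : f = c *: Gdn ug1 + a *: Gdn rn by apply/val_inj.
  apply: lin_span_cons; first exact: ugG.
  apply: lin_spanZ; have [r0|/eqP r0] := eqVneq r 0.
    by have -> : Gdn rn = 0 by [apply/val_inj]; apply: lin_span0.
  by apply: (IH (lead r)) => //; rewrite -vE; apply: rw.
have wt1 := homog_lead f0 f1.
have [Bf|NBf] := pselect (B (lead (\val f))).
  have m1 : << lead (\val f) >> * << 1%M >> = << lead (\val f) >> :> dpoly k X.
    exact: mulr1.
  have l1 : lead (<< 1%M >> : dpoly k X) = 1%M.
    by apply: leadE => [|v']; rewrite msuppU1 in_fset1 // => /eqP->.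
  exists << 1%M >>, (lead (\val f)); split.
  - by move=> /(congr1 (mcoeff 1%M)); rewrite mcoeffUU mcoeff0; apply/eqP/oner_neq0.
  - by rewrite l1 mulm1.
  - by rewrite m1; apply: homogU.
  - move=> z; rewrite m1 => zE; left; exists (lead (\val f)) => //.
    by apply/val_inj; rewrite val_gdn_word // zE.
have [u [t [s [Ss s0 fE]]]] : exists u t s,
    [/\ Sc s, dopn t s <> 0 & lead (\val f) = (u * lead (dopn t s))%M].
  apply: contrapT => h; apply: NBf; rewrite (gdn_irr_weighted_multiples wfX).
  by split=> // u t s Ss s0 fE; apply: h; exists u, t, s.
exists (dopn t s), u; split=> //.
  by have := homog_multiple u Ss s0; rewrite -fE wt1.
move=> z zE; right; apply/gdn_idealE; rewrite zE.
exact: multiple_diff_ideal.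
Qed.

(** For independence, a vanishing combination in the quotient lifts to a polynomial in Id[S]
    supported on irreducible words. Were it nonzero, its leading word would be both irreducible and
    reducible. *)
Lemma gdn_irr_basis :
  lin_basis B (fun w => \pi_(gdn_quot S) (gdn_word k w)).
Proof.
split.
  apply/seteqP; split=> // x _; rewrite -[x]reprK.
  have := gdn_spanning (repr x); move: (repr x).
  apply: (lin_span_image (f := \pi_(gdn_quot S))) => f [[w Bw <-]|If].
    by apply: lin_span_gen; exists w.
  have pf0 : \pi_(gdn_quot S) f = 0.
    by rewrite -[RHS](raddf0 \pi_(gdn_quot S)); apply/lquot_eqP; rewrite subr0.
  by rewrite [X in lin_span _ X]pf0; apply: lin_span0.
move=> r c ur rB sum0 i ir.
pose F : dpoly k X := \sum_(j <- r) c j *: << j >>.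
have coefF j : F@_j = if j \in r then c j else 0 by apply: mcoeff_sum_mon.
have FI : diff_ideal S0 F.
  rewrite /F -val_gdn_sum => [|j /rB[]//].
  apply/gdn_idealE; rewrite -[X in gdn_ideal S X]subr0.
  apply/(@lquot_eqP _ _ (gdn_ideal_submod S)).
  transitivity (0 : gdn_quot S); last by rewrite raddf0.
  rewrite -sum0 (linear_sum \pi_(gdn_quot S)).
  by apply: eq_bigr => j _; apply: pi_lquot_scale.
have F0 : F = 0.
  apply: contrapT => F0; have [u [t [s [Ss s0 FE]]]] := diff_ideal_lead wfX FI F0.
  have := lead_in F0; rewrite -mcoeff_neq0 coefF.
  case: ifPn => [/rB + _|_]; last by rewrite eqxx.
  by rewrite (gdn_irr_weighted_multiples wfX) => -[_ /(_ u t s Ss s0)]; apply.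
by have := coefF i; rewrite ir F0 mcoeff0.
Qed.

(** The map is induced by the inclusion of GDN(X) in k{X}. The two directions of [gdn_idealE] give
    its independence of representatives and its injectivity. *)
Lemma gdn_quot_embedding : exists phi : gdn_quot S -> dquot S0,
  gdn_embedding (@gdn_quot_mul k d X S) (fun x y => dquot_dop x * y) phi /\
  forall f : gdn k X, phi (\pi_(gdn_quot S) f) = \pi_(dquot S0) (\val f).
Proof.
pose phi (x : gdn_quot S) := \pi_(dquot S0) (\val (repr x)).
have phiE (f : gdn k X) : phi (\pi_(gdn_quot S) f) = \pi_(dquot S0) (\val f).
  apply/lquot_eqP; rewrite -[_ - _]/(\val (repr (\pi_(gdn_quot S) f) - f)).
  by apply/gdn_idealE/(@lquot_eqP _ _ (gdn_ideal_submod S)); rewrite reprK.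
exists phi; split=> //; split.
- move=> c x y; rewrite -[x]reprK -[y]reprK -(linearP \pi_(gdn_quot S)) !phiE.
  exact: (linearP \pi_(dquot S0)).
- move=> x y; rewrite -[x]reprK -[y]reprK -pi_gdn_quot_mul !phiE.
  rewrite -pi_dquot_dop; exact: (@pi_dquot_mul k d X S0).
- move=> x y; rewrite -[x]reprK -[y]reprK !phiE => /lquot_eqP h.
  by apply/lquot_eqP/gdn_idealE.
Qed.

End Basis.

Theorem theorem3 (k : fieldType) (char0 : [pchar k] =i pred0)
    (d : Order.disp_t) (X : orderType d)
    (wfX : well_founded (fun a b : X => (a < b)%O))
    (S : set (gdn k X)) :
  let S0 : set (dpoly k X) := [set \val f | f in S] in
  let Sc := buchberger_shirshov S0 in
  let S' : set (dpoly k X) :=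
    [set f | exists s u m,
       [/\ Sc s, dopn m s <> 0, wt (u * lead (dopn m s))%M = -1 &
           f = << u >> * dopn m s]] in
  gdn_gs_basis S' /\
  [/\ gdn_irr S' =
        [set w | wt w = -1 /\ forall u t s,
           Sc s -> dopn t s <> 0 -> w <> (u * lead (dopn t s))%M],
      gdn_irr S' = [set w | (<< w >> : dpoly k X) \in gdn_pred] `&` irr Sc,
      lin_basis (gdn_irr S') (fun w => \pi_(gdn_quot S) (gdn_word k w)) &
      exists phi : gdn_quot S -> dquot S0,
        gdn_embedding (@gdn_quot_mul k d X S)
          (fun x y => dquot_dop x * y) phi /\
        forall f : gdn k X, phi (\pi_(gdn_quot S) f) = \pi_(dquot S0) (\val f)].
Proof.
split; first exact: (weighted_multiples_gs wfX).
split.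
- exact: gdn_irr_weighted_multiples.
- exact: gdn_irrE.
- exact: gdn_irr_basis.
- exact: gdn_quot_embedding.
Qed.
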